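(* Let $f$ be a continuously differentiable function on $\mathbf{R}$, and $K>0$. Let $W$ be the Wiener process and, for $m\ge 0$ and $k\ge 0$, let $s_m(k)$ be the first passage times defined by $s_m(0)=0$ and $$s_m(k)=\min\{s: s>s_m(k-1),\ |W(s)-W(s_m(k-1))|=2^{-m}\}\qquad(k\ge 1).$$ Then the sums below converge with probability $1$ as $m\to\infty$ (the limits being the definitions of the integrals on the left): Itô integral: $$\int_0^K f(W(s))\,dW(s)=\lim_{m\to\infty}\sum_{r=1}^{K2^{2m}} f(W(s_m(r-1)))\,\bigl(W(s_m(r))-W(s_m(r-1))\bigr),$$ Stratonovich integral: $$\int_0^K f(W(s))\circ dW(s)=\lim_{m\to\infty}\sum_{r=1}^{K2^{2m}}\frac{f(W(s_m(r-1)))+f(W(s_m(r)))}{2}\,\bigl(W(s_m(r))-W(s_m(r-1))\bigr).$$ For the corresponding stochastic integrals the following formulae hold as well (with probability $1$): Itô formula: $$\int_0^{W(K)}f(x)\,dx=\int_0^K f(W(s))\,dW(s)+\frac12\int_0^K f'(W(s))\,ds,$$ Stratonovich formula: $$\int_0^{W(K)}f(x)\,dx=\int_0^K f(W(s))\circ dW(s).$$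
   Context: The Wiener process $W(t)$ ($t\ge 0$) is the standard one-dimensional Brownian motion: $W(0)=0$, continuous sample-functions, for $0\le s<t$ the increment $W(t)-W(s)$ is normal with expectation $0$ and variance $t-s$, and increments over disjoint time intervals are independent. The times $s_m(k)$ exist (are finite) with probability $1$. Convention: if the upper limit of a sum is a real number $N$, the sum goes up to $\lfloor N\rfloor$. The stochastic integrals on the left-hand sides are, by definition, the almost sure limits displayed. The integrals $\int_0^{W(K)}f(x)\,dx$ and $\int_0^K f'(W(s))\,ds$ are ordinary (pathwise Riemann) integrals, with $\int_0^a=-\int_a^0$ if $a<0$. *)

(* Defs.v *)
From HB Require Import structures.
From mathcomp Require Import all_boot all_order all_algebra.
From mathcomp Require Import all_classical all_reals all_analysis.
From mathcomp Require Import measurable_realfun.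
Import Order.TTheory GRing.Theory Num.Theory.
Import numFieldNormedType.Exports.

Set Implicit Arguments.
Unset Strict Implicit.
Unset Printing Implicit Defensive.

Local Open Scope classical_set_scope.
Local Open Scope ring_scope.

(* Taking B i = setT for some of the i gives the product rule for every
   subfamily. *)
Definition mutually_independent (R : realType) (d : measure_display)
    (T : measurableType d) (P : probability T R) (I : finType)
    (X : I -> {RV P >-> R}) : Prop :=
  forall B : I -> set R, (forall i, measurable (B i)) ->
    P (\bigcap_(i in [set: I]) (X i @^-1` B i)) =
    (\prod_(i : I) P (X i @^-1` B i))%E.
Arguments mutually_independent {R d T} P {I} X.

(* Only the values W t with 0 <= t are constrained.  The second parameter of
   normal_prob is the standard deviation, whence the square root.  The
   intervals are half-open so that abutting intervals count as disjoint. *)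
Definition wiener_process (R : realType) (d : measure_display)
    (T : measurableType d) (P : probability T R) (W : R -> {RV P >-> R}) :
    Prop :=
  [/\ forall w, W 0 w = 0,
      forall w, {within `[0, +oo[, continuous (fun t : R => W t w)},
      forall s t : R, 0 <= s -> s < t ->
        forall B : set R, measurable B ->
          distribution P (W t - W s) B = normal_prob 0 (Num.sqrt (t - s)) B
    & forall (n : nat) (s t : 'I_n -> R),
        (forall i, 0 <= s i /\ s i < t i) ->
        trivIset [set: 'I_n] (fun i => `]s i, t i]%classic) ->
        mutually_independent P (fun i => W (t i) - W (s i))].

(* The minimum of A; 0 if A has no minimum. *)
Definition set_min (R : realType) (A : set R) : R :=
  xget 0 (A `&` lbound A).

(* For a single path x : [0, +oo[ -> R. *)
Fixpoint passage_time (R : realType) (x : R -> R) (m k : nat) : R :=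
  if k is k'.+1 then
    let s' := passage_time x m k' in
    set_min [set s | s' < s /\ `|x s - x s'| = 2 ^- m]
  else 0.

Section stochastic_sums.
Context (R : realType).
Variables (f x : R -> R) (K : R).

Local Notation s := (passage_time x).

Definition ito_sum (m : nat) : R :=
  \sum_(1 <= r < (Num.truncn (K * 2 ^+ (2 * m))).+1)
    f (x (s m r.-1)) * (x (s m r) - x (s m r.-1)).

Definition stratonovich_sum (m : nat) : R :=
  \sum_(1 <= r < (Num.truncn (K * 2 ^+ (2 * m))).+1)
    (f (x (s m r.-1)) + f (x (s m r))) / 2 * (x (s m r) - x (s m r.-1)).

(* Meaningful only where the sums converge. *)
Definition ito_integral : R := limn ito_sum.

Definition stratonovich_integral : R := limn stratonovich_sum.

End stochastic_sums.

(* For continuous g the Lebesgue integral over a compact interval is the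
   Riemann integral. *)
Definition oriented_integral (R : realType) (g : R -> R) (a b : R) : R :=
  if a <= b then \int[lebesgue_measure]_(x in `[a, b]) g x
  else - \int[lebesgue_measure]_(x in `[b, a]) g x.

(* Main.v *)
Require Import Defs.
From HB Require Import structures.
From mathcomp Require Import all_boot all_order all_algebra.
From mathcomp Require Import all_classical all_reals all_analysis.
From mathcomp Require Import measurable_realfun ring lra zify.
Import Order.TTheory GRing.Theory Num.Theory.
Import numFieldNormedType.Exports.

(** Let h = 2^-m and let x_r = W(s_m(r)).  As |x_r - x_(r-1)| = h, a
    second-order Taylor expansion of a primitive F of f, with remainder o(h^2)
    over about K h^-2 steps, turns both sums into F(x_N) - F(0) + o(1), for the
    Ito sum up to the correction h^2/2 sum_r f'(x_(r-1)).  Everything then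
    follows from: almost surely, s_m(k) - k h^2 tends to 0 uniformly over
    k <= K h^-2.

    By monotonicity it is enough that, for each positive rational t, the number
    J of passages before t satisfies J h^2 --> t.  No strong Markov property is
    used.  On a time grid of mesh t/N let y follow the sampled path w with
    hysteresis on the lattice hZ ([tracker]); each jump of y changes
    (w - y)^2 by an extra -h^2, up to a small error, so that
      J h^2 = sum (Delta w)^2 + 2 sum (w - y) Delta w - (w_N - y_N)^2 + error.
    The second sum is a martingale transform with integrand bounded by h, hence
    has second moment at most h^2 t, and the first one is t + o(1) as N grows.
    For infinitely many N both deviations are small, by a Borel-Cantelli
    argument in m.  Finally, the number of jumps of y is a lower (strict
    hysteresis) or an upper (tolerance e = h^2) bound for the number of
    passages once the mesh is fine enough. *)

Set Implicit Arguments.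
Unset Strict Implicit.
Unset Printing Implicit Defensive.

Local Open Scope classical_set_scope.
Local Open Scope ring_scope.

(** * Lattice tracking of a sampled path *)

Section tracker.
Context {R : realType}.
Implicit Types (h e o : R) (w : nat -> R) (i : nat).

(* The lattice point of [h Z] followed by the sampled path [w], abandoned for a
   neighbour as soon as [w] is within [e] of it, or beyond it. *)
Fixpoint tracker h e w i : R :=
  if i is i'.+1 then
    let y := tracker h e w i' in
    if y + (h - e) <= w i then y + h
    else if w i <= y - (h - e) then y - h else y
  else 0.

Definition jumps h e w i : nat :=
  \sum_(k < i) (tracker h e w k.+1 != tracker h e w k).

Lemma jumpsS h e w i : jumps h e w i.+1 =
  (jumps h e w i + (tracker h e w i.+1 != tracker h e w i))%N.
Proof. by rewrite /jumps big_ord_recr. Qed.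

Lemma leq_jumps h e w : {homo jumps h e w : i j / (i <= j)%N}.
Proof.
move=> i j /subnK <-; elim: (j - i)%N => // n IH.
by rewrite addSn jumpsS; apply: leq_trans IH (leq_addr _ _).
Qed.

Lemma jumps_lt h e w i j : (i <= j)%N ->
  tracker h e w i != tracker h e w j -> (jumps h e w i < jumps h e w j)%N.
Proof.
move=> /subnK <-; elim: (j - i)%N => [|n IH]; first by rewrite eqxx.
rewrite addSn jumpsS => yij.
have [yin|/IH] := eqVneq (tracker h e w i) (tracker h e w (n + i)); last first.
  by move=> h1; apply: leq_trans h1 (leq_addr _ _).
rewrite -yin eq_sym yij addn1 ltnS; apply: leq_jumps; exact: leq_addl.
Qed.

Definition lattice h (y : R) := exists z : int, y = z%:~R * h.

Lemma lattice_tracker h e w i : lattice h (tracker h e w i).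
Proof.
elim: i => [|i [z zE]] /=; first by exists 0; rewrite mul0r.
case: ifP => _; first by exists (z + 1); rewrite zE rmorphD/= mulrDl mul1r.
case: ifP => _; last by exists z.
by exists (z - 1); rewrite zE rmorphB/= mulrBl mul1r.
Qed.

Lemma lattice_eq h y y' : 0 < h -> lattice h y -> lattice h y' ->
  `|y - y'| < h -> y = y'.
Proof.
move=> h0 [z ->] [z' ->]; rewrite -mulrBl -rmorphB/= normrM (gtr0_norm h0).
rewrite gtr_pMl// -intr_norm -[ltRHS]/(1%:~R) ltr_int => zz'.
by have -> : z = z' by lia.
Qed.

Lemma lattice_near h y x : 0 < h -> lattice h y -> lattice h x -> y != x ->
  h <= `|y - x|.
Proof.
move=> h0 ly lx; apply: contraNT; rewrite -ltNge => yx.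
exact/eqP/(lattice_eq h0).
Qed.

Section invariants.
Variables (h e o : R) (w : nat -> R) (N : nat).
Hypotheses (h0 : 0 < h) (e0 : 0 <= e) (o0 : 0 <= o) (eoh : e + o < h - e).
Hypothesis w0 : w 0%N = 0.
Hypothesis osc : forall i, (i < N)%N -> `|w i.+1 - w i| <= o.
Local Notation y := (tracker h e w).
Local Notation J := (jumps h e w).

(** A jump occurs at distance at least [h - e], and a step moves the path by at most [o], so the
    path ends within [e + o] of the new lattice point. By [eoh] this is below [h - e]: the invariant
    of [tracker_close] survives, and one neighbour per step suffices. *)
Lemma tracker_step i : (i < N)%N -> `|w i - y i| < h - e ->
  [\/ y i.+1 = y i /\ `|w i.+1 - y i| < h - e,
      y i.+1 = y i + h /\ `|w i.+1 - y i - h| <= e + o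
    | y i.+1 = y i - h /\ `|w i.+1 - y i + h| <= e + o].
Proof.
move=> iN; have := osc iN; have e0' := e0; have o0' := o0.
rewrite [y i.+1]/=; move: (y i) (w i) (w i.+1) => z x x'.
rewrite ler_norml ltr_norml => /andP[d1 d2] /andP[wy1 wy2].
case: ifPn => up.
  by apply: Or32; split => //; rewrite ler_norml; apply/andP; split; lra.
move: up; rewrite -ltNge => up; case: ifPn => dn.
  by apply: Or33; split => //; rewrite ler_norml; apply/andP; split; lra.
move: dn; rewrite -ltNge => dn; apply: Or31; split => //.
by rewrite ltr_norml; apply/andP; split; lra.
Qed.

Lemma tracker_close i : (i <= N)%N -> `|w i - y i| < h - e.
Proof.
elim: i => [|i IH] iN.
  by rewrite w0 subrr normr0; have := eoh; have := e0; have := o0; lra.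
have [[-> //]|[-> h1]|[-> h1]] := tracker_step iN (IH (ltnW iN)).
- by rewrite opprD addrA; apply: le_lt_trans h1 _.
- by rewrite opprB addrA addrAC; apply: le_lt_trans h1 _.
Qed.

(** Without a jump [(w - y) ^+ 2] grows by [2 (w - y) Δw + (Δw) ^+ 2]. Replacing [y] by [y' = y ± h]
    adds [- h ^+ 2 ∓ 2 h (w' - y')], whose last factor is at most [e + o] in absolute value by
    [tracker_step]. *)
Lemma tracker_energy i : (i <= N)%N ->
  `|(J i)%:R * h ^+ 2 - \sum_(k < i) (w k.+1 - w k) ^+ 2
    - 2 * (\sum_(k < i) (w k - y k) * (w k.+1 - w k)) + (w i - y i) ^+ 2|
  <= 2 * h * (e + o) * (J i)%:R.
Proof.
elim: i => [|i IH] iN.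
  rewrite /jumps !big_ord0 w0 subrr expr0n/= mul0r mulr0 !subr0 addr0 normr0.
  by rewrite mulr0.
have {IH} := IH (ltnW iN).
have := tracker_step iN (tracker_close (ltnW iN)).
rewrite jumpsS !big_ord_recr -/(y i.+1).
move: (y i.+1) => y'; move: (y i) (\sum_(k < i) (w k.+1 - w k) ^+ 2)
  (\sum_(k < i) (w k - y k) * (w k.+1 - w k)) (w i) (w i.+1) => y0 Q D x x'.
have e1 (u v : R) c : u = v -> `|u| <= c -> `|v| <= c by move=> ->.
have hn0 : h != 0 by rewrite gt_eqF.
have h0' := h0; have e0' := e0; have o0' := o0.
case=> [[-> h1]|[-> h1]|[-> h1]] /= h2.
- by rewrite eqxx addn0; apply: e1 h2; ring.
- have -> : (y0 + h != y0) by rewrite -subr_eq0 addrC addKr.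
  rewrite natrD/=.
  move: h2 h1; rewrite !ler_norml => /andP[h2 h3] /andP[h4 h5]; nra.
- have -> : (y0 - h != y0) by rewrite -subr_eq0 addrC addKr oppr_eq0.
  rewrite natrD/=.
  move: h2 h1; rewrite !ler_norml => /andP[h2 h3] /andP[h4 h5]; nra.
Qed.

End invariants.
End tracker.

(** * Passage times of a continuous path *)

Section passage_times.
Context {R : realType}.
Implicit Types (x : R -> R) (m k : nat).

Lemma set_minP (A : set R) a : A a -> lbound A a -> set_min A = a.
Proof.
move=> Aa la; rewrite /set_min; apply: xget_unique => // b [Ab lb].
by apply/eqP; rewrite eq_le la// lb.
Qed.

Lemma passage_time_ge0 x m k : 0 <= passage_time x m k.
Proof.
elim: k => [//|k IH] /=; rewrite /set_min.
by case: xgetP => [a -> [[/ltW + _] _]|//]; exact: le_trans.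
Qed.

(** Wiener paths are only known to be continuous at nonnegative times. Their even extension is
    continuous on the whole line, and passage times, being nonnegative, do not see the extension. *)
Lemma passage_time_normr x m k :
  passage_time (fun t => x `|t|) m k = passage_time x m k.
Proof.
elim: k => [//|k IH] /=; rewrite IH; congr set_min.
have s0 := passage_time_ge0 x m k.
by apply/seteqP; split => u /= [su]; rewrite (ger0_norm s0);
  rewrite (ger0_norm (le_trans s0 (ltW su))).
Qed.

(* The first [k] passage times are genuine minima, not the junk value [0]. *)
Definition passed x m k := forall j, (j < k)%N -> exists u,
  passage_time x m j < u /\ `|x u - x (passage_time x m j)| = 2 ^- m.

Lemma passed_leq x m j k : (j <= k)%N -> passed x m k -> passed x m j.
Proof. by move=> jk pk i ij; apply: pk; exact: leq_trans ij jk. Qed.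

Section continuous_path.
Variables (x : R -> R) (m : nat).
Hypotheses (cx : continuous x) (x0 : x 0 = 0).
Local Notation h := (2 ^- m : R).
Local Notation s := (passage_time x m).

Let h0 : 0 < h. Proof. by rewrite invr_gt0 exprn_gt0. Qed.

(** The times of [[s k, c]] at distance [h] from [x (s k)] form a nonempty compact set. Its least
    element is not [s k], where the distance is 0, so it is the required minimum. *)
Lemma passage_timeS k : passed x m k.+1 ->
  [/\ s k < s k.+1, `|x (s k.+1) - x (s k)| = h &
    forall u, s k < u -> `|x u - x (s k)| = h -> s k.+1 <= u].
Proof.
move=> /(_ k (ltnSn k)) [c [sc xc]].
pose A := [set u | s k < u /\ `|x u - x (s k)| = h].
pose B := `[s k, c] `&` (fun u => `|x u - x (s k)|) @^-1` [set h].
have cg : continuous (fun u => `|x u - x (s k)|).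
  move=> u; apply: cvg_norm; apply: cvgB; [exact: cx|exact: cvg_cst].
have cB : compact B.
  apply: compact_closedI; first exact: segment_compact.
  by apply: preimage_closed; [move=> u _; exact: cg|exact: closed_eq].
have Bc : B c by split => //=; rewrite in_itv/= lexx (ltW sc).
have [a] := @compact_EVT_min R R id B (ex_intro _ c Bc) cB
  (continuous_subspaceT (fun=> cvg_id)).
rewrite inE => -[sac xa] mina.
have /andP[sa ac] : s k <= a <= c by move: sac; rewrite /= in_itv.
have sa' : s k < a.
  rewrite lt_neqAle sa andbT; apply/eqP => E; move: xa.
  by rewrite -E /= subrr normr0 => E0; have := h0; rewrite -E0 ltxx.
have Aa : A a by [].
have la : lbound A a.
  move=> u [su xu]; have [uc|/ltW cu] := leP u c; last exact: le_trans cu.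
  by apply: mina; rewrite inE; split => //=; rewrite in_itv/= uc (ltW su).
have sE : s k.+1 = a by apply: set_minP.
rewrite sE.
by split=> // u su xu; apply: la.
Qed.

Lemma passage_time_lt j k : (j < k)%N -> passed x m k -> s j < s k.
Proof.
elim: k => // k IH; rewrite ltnS leq_eqVlt => /predU1P[->|jk] pk.
  by have [] := passage_timeS pk.
apply: lt_trans (IH jk (passed_leq (leqnSn k) pk)) _.
by have [] := passage_timeS pk.
Qed.

Lemma passage_time_le j k : (j <= k)%N -> passed x m k -> s j <= s k.
Proof.
by rewrite leq_eqVlt => /predU1P[-> //|jk] pk; exact/ltW/passage_time_lt.
Qed.

Lemma lattice_passage_time k : passed x m k -> lattice h (x (s k)).
Proof.
elim: k => [|k IH] pk; first by exists 0; rewrite /= x0 mul0r.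
have [z zE] := IH (passed_leq (leqnSn k) pk).
have [_ xh _] := passage_timeS pk.
have /orP[/eqP E|/eqP E] :
    (x (s k.+1) - x (s k) == h) || (x (s k.+1) - x (s k) == - h).
  by rewrite -eqr_norm2 (gtr0_norm h0) xh.
- by exists (z + 1); rewrite intrD mulrDl mul1r -zE -E subrKC.
- by exists (z - 1); rewrite intrB mulrBl mul1r -zE -E subrKC.
Qed.

(** Distinct lattice points are at least [h] apart, so the distance from [x (s k)] takes the value
    [h] on [[s k, v]] by the intermediate value theorem. *)
Lemma passed_hit k v : passed x m k -> s k <= v -> lattice h (x v) ->
  x v != x (s k) -> passed x m k.+1 /\ s k.+1 <= v.
Proof.
move=> pk sv lv xv.
have hv := lattice_near h0 lv (lattice_passage_time pk) xv.
pose g u := `|x u - x (s k)|.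
have cg : continuous g.
  move=> u; apply: cvg_norm; apply: cvgB; [exact: cx|exact: cvg_cst].
have [||c] := @IVT R g (s k) v h sv.
- exact: continuous_subspaceT.
- by rewrite /g subrr normr0 min_l// max_r// (ltW h0).
rewrite in_itv/= => /andP[sc cv] gc.
have sc' : s k < c.
  rewrite lt_neqAle sc andbT; apply/eqP => E; move: gc.
  by rewrite /g -E subrr normr0 => E0; have := h0; rewrite -E0 ltxx.
have pk1 : passed x m k.+1.
  move=> j; rewrite ltnS leq_eqVlt => /predU1P[->|/pk//].
  by exists c.
split=> //; apply: le_trans cv.
by have [_ _] := passage_timeS pk1; apply.
Qed.

(** Two different lattice values cannot both equal [x (s k)], so [passed_hit] applies at [u] or at
    [v]. *)
Lemma passed_chain k u v : passed x m k -> s k <= u -> u <= v ->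
  lattice h (x u) -> lattice h (x v) -> x u != x v ->
  passed x m k.+1 /\ s k.+1 <= v.
Proof.
move=> pk su uv lu lv xuv.
have [xu|xu] := eqVneq (x u) (x (s k)).
  by apply: passed_hit => //; [exact: le_trans uv|rewrite -xu eq_sym].
have [p1 s1] := passed_hit pk su lu xu.
by split=> //; exact: le_trans uv.
Qed.

Section sampling.
Variables (δ : R) (N : nat).
Hypothesis (δ0 : 0 < δ).
Local Notation w := (fun i : nat => x (i%:R * δ)).

(** With zero tolerance a jump means that the path has really reached the new lattice point between
    two grid times, and two different lattice values visited in succession force a new passage. *)
Lemma jumps_passed (o : R) : 0 <= o -> o < h ->
  (forall i, (i < N)%N -> `|w i.+1 - w i| <= o) ->
  passed x m (jumps h 0 w N) /\ s (jumps h 0 w N) <= N%:R * δ.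
Proof.
move=> o0 oh osc.
(* The induction carries a time [u] at which the path equals the tracker; [passed_chain] starts from
   it at the next jump. *)
suff : forall i, (i <= N)%N -> exists u, [/\ passed x m (jumps h 0 w i),
    s (jumps h 0 w i) <= u, u <= i%:R * δ & x u = tracker h 0 w i].
  by move=> /(_ N (leqnn N))[u [pN sN uN _]]; split=> //; exact: le_trans uN.
have eoh : 0 + o < h - 0 by rewrite add0r subr0.
have w0 : w 0%N = 0 by rewrite /= mul0r.
elim=> [|i IH] iN.
  by exists 0; rewrite /jumps big_ord0 mul0r; split => // j.
have [u [pu su ui xu]] := IH (ltnW iN).
have ii : i%:R * δ <= i.+1%:R * δ by rewrite ler_pM2r// ler_nat.
have := tracker_close (lexx 0) o0 eoh w0 osc (ltnW iN).
rewrite subr0 ltr_norml => /andP[wy1 wy2].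
have jump (z : R) : tracker h 0 w i.+1 = z -> z != tracker h 0 w i ->
    Num.min (w i) (w i.+1) <= z <= Num.max (w i) (w i.+1) ->
    exists v, [/\ passed x m (jumps h 0 w i.+1),
      s (jumps h 0 w i.+1) <= v, v <= i.+1%:R * δ & x v = tracker h 0 w i.+1].
  move=> yz zy zw; rewrite jumpsS yz zy addn1.
  have [v] := IVT ii (continuous_subspaceT cx) zw.
  rewrite in_itv/= => /andP[iv vi] xv; exists v.
  have [] := @passed_chain _ u v pu su (le_trans ui iv).
  - by rewrite xu; exact: lattice_tracker.
  - by rewrite xv -yz; exact: lattice_tracker.
  - by rewrite xu xv eq_sym.
  - by move=> p1 s1; split.
have h0' := h0.
have := jump (tracker h 0 w i.+1) erefl.
rewrite [tracker h 0 w i.+1]/= !subr0; case: ifPn => up.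
  apply; first by rewrite -subr_eq0 addrC addKr gt_eqF.
  by rewrite ge_min le_max up/= orbT andbT; apply/orP; left; lra.
case: ifPn => dn.
  move=> H; apply: H; first by rewrite -subr_eq0 addrC addKr oppr_eq0 gt_eqF.
  by rewrite ge_min le_max dn/= orbT/=; apply/orP; left; lra.
move=> _; exists u; rewrite jumpsS /= !subr0 (negbTE up) (negbTE dn) eqxx addn0.
by split=> //; exact: le_trans ii.
Qed.

(** At a grid time just after [s j] the path is within [e] of [x (s j)] and the tracker within
    [h - e] of the path. Tracker and [x (s j)] are then lattice points less than [h] apart, hence
    equal ([key]). Successive passages have different values, so the tracker jumps in between. *)
Lemma passed_jumps (e : R) k : 0 < e -> e + e < h - e ->
  (forall u v, 0 <= u -> u <= v -> v <= u + δ -> v <= N%:R * δ -> `|x v - x u| < e) ->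
  passed x m k -> s k <= N%:R * δ -> (k <= jumps h e w N)%N.
Proof.
move=> e0 eeh osc pk sk.
have w0 : w 0%N = 0 by rewrite /= mul0r.
have oscw i : (i < N)%N -> `|w i.+1 - w i| <= e.
  move=> iN; apply/ltW/osc; first by rewrite mulr_ge0// ltW.
  - by rewrite ler_pM2r// ler_nat.
  - by rewrite -natr1 mulrDl mul1r.
  - by rewrite ler_pM2r// ler_nat.
have key i j : (j <= k)%N -> (i <= N)%N -> s j <= i%:R * δ ->
    i%:R * δ <= s j + δ -> tracker h e w i = x (s j).
  move=> jk iN si isj; apply: (lattice_eq h0) => //.
  - exact: lattice_tracker.
  - exact/lattice_passage_time/(passed_leq jk).
  have h1 : `|x (i%:R * δ) - x (s j)| < e.
    apply: osc => //; first exact: passage_time_ge0.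
    by rewrite ler_pM2r// ler_nat.
  have h2 := tracker_close (ltW e0) (ltW e0) eeh w0 oscw iN.
  apply: (le_lt_trans (ler_distD (w i) _ _)).
  by rewrite distrC; apply: (lt_le_trans (ltrD h2 h1)); rewrite subrK.
suff : forall j, (j <= k)%N -> exists i, [/\ (i <= N)%N, s j <= i%:R * δ,
    i%:R * δ < s j + δ & (j <= jumps h e w i)%N].
  move=> /(_ k (leqnn k))[i [iN _ _ ki]].
  by apply: leq_trans ki _; exact: leq_jumps.
elim=> [|j IH] jk; first by exists 0%N; rewrite mul0r add0r.
have [i [iN si isj ji]] := IH (ltnW jk).
have [sjj xjj _] := passage_timeS (passed_leq jk pk).
have exi : exists i : nat, s j.+1 <= i%:R * δ.
  by exists N; apply: le_trans sk; exact: passage_time_le.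
(* The least grid index not before [s j.+1]; minimality puts it less than [δ] after the passage, as
   [key] requires. *)
pose i' := ex_minn exi.
have [si' mini'] : s j.+1 <= i'%:R * δ /\
    forall n : nat, s j.+1 <= n%:R * δ -> (i' <= n)%N.
  by rewrite /i'; case: ex_minnP.
have i'N : (i' <= N)%N by apply: mini'; apply: le_trans sk; exact: passage_time_le.
have si'2 : i'%:R * δ < s j.+1 + δ.
  case E : i' => [|n].
    by rewrite mul0r ltr_wpDl// passage_time_ge0.
  rewrite -natr1 mulrDl mul1r ltrD2r ltNge; apply/negP => /mini'.
  by rewrite E ltnn.
have ii' : (i <= i')%N.
  have : i%:R * δ < i'.+1%:R * δ.
    apply: (lt_le_trans isj); rewrite -natr1 mulrDl mul1r lerD2r.
    exact: le_trans (ltW sjj) si'.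
  by rewrite ltr_pM2r// ltr_nat ltnS.
exists i'; split=> //; apply: (leq_ltn_trans ji); apply: jumps_lt => //.
rewrite (key i j (ltnW jk) iN si (ltW isj)) (key i' j.+1 jk i'N si' (ltW si'2)).
apply/eqP => E; move: xjj; rewrite E subrr normr0 => E0.
by have := h0; rewrite -E0 ltxx.
Qed.

End sampling.
End continuous_path.
End passage_times.

(** * Calculus *)

Section calculus.
Context {R : realType}.
Local Notation mu := (@lebesgue_measure R).
Implicit Types g f F : R -> R.

(** Slightly more than uniform continuity on [[- M, M]]: only [a] is confined there. Local estimates
    are made uniform by compactness. *)
Lemma uniformly_continuous_bounded g (M ε : R) : continuous g -> 0 < ε ->
  exists2 δ, 0 < δ & forall a b, `|a| <= M -> `|a - b| < δ -> `|g a - g b| < ε.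
Proof.
move=> cg e0.
have cK : compact `[- M, M]%classic by exact: segment_compact.
have H : forall x, `[- M, M]%classic x -> \forall a \near x & δ \near 0^'+,
    forall b, `|a - b| < δ -> `|g a - g b| < ε.
  move=> x _.
  have /cvgrPdist_lt/(_ (ε / 2)) := cg x.
  rewrite divr_gt0// => /(_ isT) /nbhs_ballP[r /= r0 gr].
  near=> a δ => b ab.
  have xa : `|x - a| < r / 2.
    by near: a; apply/nbhs_ballP; exists (r / 2); rewrite //= divr_gt0.
  have dr : δ < r / 2 by near: δ; apply: nbhs_right_lt; rewrite divr_gt0.
  have ga : `|g x - g a| < ε / 2.
    by apply: gr; apply: lt_trans xa _; rewrite ltr_pdivrMr// ltr_pMr// ltr1n.
  have gb : `|g x - g b| < ε / 2.
    apply: gr; rewrite /ball/=; apply: (le_lt_trans (ler_distD a _ _)).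
    by rewrite [ltRHS]splitr ltrD//; exact: lt_trans dr.
  apply: (le_lt_trans (ler_distD (g x) _ _)).
  by rewrite [ltRHS]splitr ltrD// distrC.
have FF : Filter ((0 : R)^'+) by typeclasses eauto.
have hd := (compact_near_coveringP _).1 cK _ ((0 : R)^'+)
  (fun δ a => forall b, `|a - b| < δ -> `|g a - g b| < ε) FF H.
have [δ [d0 hδ]] : exists δ : R, 0 < δ /\ forall a, `[- M, M]%classic a ->
    forall b, `|a - b| < δ -> `|g a - g b| < ε.
  near ((0 : R)^'+) => δ; exists δ; split; last by near: δ.
  by near: δ; exact: nbhs_right_gt.
exists δ => // a b aM; apply: hδ.
by rewrite /= in_itv/= -ler_norml.
Unshelve. all: by end_near. Qed.

Lemma is_derive_oriented_integral g (y : R) : continuous g ->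
  is_derive y 1 (oriented_integral g 0) (g y).
Proof.
(* The base point [a] lies below both 0 and [y], so near [y] the oriented integral is a difference
   of integrals from [a], whatever the sign of [y]. *)
move=> cg; pose a : R := - (`|y| + 1); pose b : R := `|y| + 1.
have ib (u v : R) : mu.-integrable `[u, v] (EFin \o g).
  by apply: continuous_compact_integrable; [exact: segment_compact|
     exact: continuous_subspaceT].
have y0 : 0 <= `|y| by [].
have ya : a < y by rewrite /a; have := lerNnormlW (lexx `|y|); lra.
have yb : y < b by rewrite /b; have := ler_norm y; lra.
pose G z := \int[mu]_(t in `[a, z]) g t.
have [dG G'] : derivable G y 1 /\ derive1 G y = g y.
  exact: (continuous_FTC1_closed yb (ib a b) ya (cg y)).
have GE z : a < z -> oriented_integral g 0 z = G z - G 0.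
  move=> az; rewrite /oriented_integral; case: ifPn => z0.
    rewrite -(Rintegral_itv_obnd_cbnd (r := 0) (b := BRight z)).
      by rewrite /G Rintegral_itvB// ?bnd_simp// /a; lra.
    by apply: (integrableS _ _ _ (ib 0 z)) => //; exact: subset_itv_oc_cc.
  rewrite -(Rintegral_itv_obnd_cbnd (r := z) (b := BRight 0)).
    rewrite -[RHS]opprB /G Rintegral_itvB// ?bnd_simp//; first exact: ltW.
    by rewrite ltW// ltNge.
  by apply: (integrableS _ _ _ (ib z 0)) => //; exact: subset_itv_oc_cc.
apply: (@near_eq_is_derive _ _ _ (fun z => G z - G 0)).
  near=> z; rewrite GE//; near: z.
  by apply: lt_nbhsr.
have dG' : is_derive y 1 G (g y).
  by apply: DeriveDef => //; rewrite -G' derive1E.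
by apply: is_derive_eq; rewrite subr0.
Unshelve. all: by end_near. Qed.

Lemma oriented_integral00 g : oriented_integral g 0 0 = 0.
Proof. by rewrite /oriented_integral lexx set_itv1 Rintegral_set1. Qed.

Lemma mean_value F f (a b : R) : (forall x : R, is_derive x 1 F (f x)) ->
  exists c, [/\ Num.min a b <= c, c <= Num.max a b & F b - F a = f c * (b - a)].
Proof.
move=> dF.
have cF : continuous F.
  move=> x; apply: differentiable_continuous; apply/derivable1_diffP.
  by case: (dF x).
have [ab|/ltW ba] := leP a b.
  have [c] := MVT_segment ab (fun x _ => dF x) (continuous_subspaceT cF).
  by rewrite in_itv/= => /andP[ac cb] E; exists c; split.
have [c] := MVT_segment ba (fun x _ => dF x) (continuous_subspaceT cF).
rewrite in_itv/= => /andP[bc ca] E; exists c; split => //.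
by rewrite -opprB E -mulrN opprB.
Qed.

Lemma between_close (a b c : R) : Num.min a b <= c -> c <= Num.max a b ->
  `|c - a| <= `|b - a|.
Proof.
have [ab|/ltW ba] := leP a b => ac cb.
  by rewrite !ger0_norm ?subr_ge0// lerD2r.
by rewrite ![`|_ - a|]distrC !ger0_norm ?subr_ge0// lerD2l lerN2.
Qed.

(** The mean value theorem is applied to the remainder [Φ], whose derivative is
    [f z - f a - f' a * (z - a)], and then to [f]. *)
Lemma taylor2 F f f' (a b ε : R) : (forall x : R, is_derive x 1 F (f x)) ->
  (forall x : R, is_derive x 1 f (f' x)) ->
  (forall c, `|c - a| <= `|b - a| -> `|f' c - f' a| <= ε) ->
  `|F b - F a - f a * (b - a) - f' a * (b - a) ^+ 2 / 2| <= ε * (b - a) ^+ 2.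
Proof.
move=> dF df hε.
pose Φ (z : R) := F z - F a - f a * (z - a) - f' a * (z - a) ^+ 2 / 2.
have dΦ (z : R) : is_derive z 1 Φ (f z - f a - f' a * (z - a)).
  have := dF z => ?; rewrite /Φ.
  by apply: is_derive_eq; rewrite /GRing.scale/=; field.
have [c [c1 c2 E]] := mean_value a b dΦ.
have Φa : Φ a = 0 by rewrite /Φ; ring.
rewrite Φa subr0 in E; rewrite -/(Φ b) E.
have ca := between_close c1 c2.
have [e [e1 e2 E2]] := mean_value a c df.
have ea := between_close e1 e2.
rewrite E2 -mulrBl !normrM -mulrA ler_pM ?mulr_ge0//.
- by apply: hε; exact: le_trans ca.
- by rewrite -[X in _ <= X]ger0_norm ?sqr_ge0// expr2 normrM ler_wpM2r.
Qed.

(** As [f b - f a = f' c * (b - a)], averaging the endpoint values contributes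
    [f' c * (b - a) ^+ 2 / 2], which cancels the second-order Taylor term up to a small error. This
    is why the Stratonovich formula has no correction. *)
Lemma taylor2_trapezoid F f f' (a b ε : R) :
  (forall x : R, is_derive x 1 F (f x)) ->
  (forall x : R, is_derive x 1 f (f' x)) ->
  (forall c, `|c - a| <= `|b - a| -> `|f' c - f' a| <= ε) ->
  `|F b - F a - (f a + f b) / 2 * (b - a)| <= 2 * ε * (b - a) ^+ 2.
Proof.
move=> dF df hε; have := taylor2 dF df hε.
have [c [c1 c2 E]] := mean_value a b df.
have := hε _ (between_close c1 c2); rewrite !ler_norml => /andP[h1 h2] /andP[h3 h4].
have -> : f b = f a + f' c * (b - a) by rewrite -E; ring.
have := sqr_ge0 (b - a); move: h3 h4.
have -> : (f a + (f a + f' c * (b - a))) / 2 * (b - a) =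
  f a * (b - a) + f' c * (b - a) ^+ 2 / 2 by field.
move: (f a * (b - a)) ((b - a) ^+ 2) => v s h3 h4 s0.
have p1 : 0 <= (f' c - f' a + ε) * s by rewrite mulr_ge0//; lra.
have p2 : 0 <= (ε - (f' c - f' a)) * s by rewrite mulr_ge0//; lra.
by apply/andP; split; nra.
Qed.

End calculus.

(** * Convergence of the sums along regular passage times *)

Section pathwise_convergence.
Context {R : realType}.
Local Notation s := (@passage_time R).

(** Besides continuity and the value at 0, this is all that the convergence of the sums requires of
    a path. *)
Definition regular_passages (x : R -> R) (K : R) := forall η, 0 < η ->
  \forall m \near \oo, forall k : nat, k%:R <= K * 2 ^+ (2 * m) ->
    passed x m k /\ `|s x m k - k%:R * 2 ^- (2 * m)| <= η.

Variables (x : R -> R) (K : R).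
Hypotheses (cx : continuous x) (x0 : x 0 = 0) (K0 : 0 < K).
Hypothesis reg : regular_passages x K.
Local Notation N m := (Num.truncn (K * 2 ^+ (2 * m))).
Local Notation d m := (2 ^- (2 * m) : R).

Let d0 m : 0 < d m. Proof. by rewrite invr_gt0 exprn_gt0. Qed.

Lemma steps_le m k : (k <= N m)%N -> k%:R <= K * 2 ^+ (2 * m).
Proof.
move=> kN; apply: (@le_trans _ _ (N m)%:R); first by rewrite ler_nat.
by rewrite truncn_le// mulr_ge0 ?ltW// exprn_gt0.
Qed.

Lemma steps_time m : (N m)%:R * d m <= K /\ `|K - (N m)%:R * d m| <= d m.
Proof.
have p0 : (0 : R) < 2 ^+ (2 * m) by rewrite exprn_gt0.
have Nd : (N m)%:R * d m <= K by rewrite ler_pdivrMr//; exact: steps_le.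
split=> //; rewrite ger0_norm ?subr_ge0// lerBlDr -[X in X + _]mul1r -mulrDl.
by rewrite ler_pdivlMr// nat1r ltW// truncnS_gt.
Qed.

Lemma near_step_size_lt (ε : R) : 0 < ε -> \forall m \near \oo, 2 ^- m < ε.
Proof.
move=> e0.
have /cvgr0Pnorm_lt/(_ _ e0) : (GRing.exp (2^-1 : R)) @ \oo --> 0.
  by apply: cvg_expr; rewrite ger0_norm ?invr_ge0// invf_lt1// ltr1n.
by apply: filterS => m; rewrite -exprVn ger0_norm.
Qed.

Lemma near_mesh_lt (ε : R) : 0 < ε -> \forall m \near \oo, d m < ε.
Proof.
move=> e0; apply: filterS (near_step_size_lt e0) => m; apply: le_lt_trans.
rewrite lef_pV2 ?posrE ?exprn_gt0// ler_weXn2l ?ler1n//.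
by rewrite mul2n -addnn leq_addl.
Qed.

Lemma ler_norm_sumB (u v : nat -> R) n c :
  (forall r, (r < n)%N -> `|u r - v r| <= c) ->
  `|\sum_(r < n) u r - \sum_(r < n) v r| <= n%:R * c.
Proof.
move=> uv; rewrite -sumrB; apply: (le_trans (ler_norm_sum _ _ _)).
rewrite -[X in X%:R]card_ord mulr_natl -sumr_const.
by apply: ler_sum => r _; exact: uv.
Qed.

(** On each cell of the uniform mesh [d m] the integral is [g c * d m] by the mean value theorem,
    and [s x m r] is close to the cell, hence to [c]. *)
Lemma riemann_sum_passage_times (g : R -> R) (ε : R) : continuous g -> 0 < ε ->
  \forall m \near \oo,
    `|oriented_integral g 0 K - d m * \sum_(r < N m) g (s x m r)| <= ε.
Proof.
move=> cg e0.
have K1 : 0 < K + 1 by rewrite addr_gt0.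
(* One share pays for the incomplete last cell; the full cells, of total length at most [K], take
   the other [K] shares. *)
have e1 : 0 < ε / (K + 1) by rewrite divr_gt0.
have [δ δ0 hδ] := uniformly_continuous_bounded K cg e1.
have cI : continuous (oriented_integral g 0).
  move=> y; apply: differentiable_continuous; apply/derivable1_diffP.
  by case: (is_derive_oriented_integral y cg).
have [δ' δ'0 hδ'] := uniformly_continuous_bounded K cI e1.
have δ2 : 0 < δ / 2 by rewrite divr_gt0.
near=> m.
have dδ : d m < δ / 2 by near: m; exact: near_mesh_lt.
have dδ' : d m < δ' by near: m; exact: near_mesh_lt.
have rm : forall k : nat, k%:R <= K * 2 ^+ (2 * m) ->
    passed x m k /\ `|s x m k - k%:R * d m| <= δ / 2 by near: m; exact: reg.
have [NK KN] := steps_time m.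
pose I r := oriented_integral g 0 (r%:R * d m).
have H1 : `|oriented_integral g 0 K - I (N m)| <= ε / (K + 1).
  by apply/ltW/hδ'; [rewrite ger0_norm// ltW|exact: le_lt_trans dδ'].
have H2 : `|\sum_(r < N m) (I r.+1 - I r) - \sum_(r < N m) d m * g (s x m r)|
    <= (N m)%:R * (d m * (ε / (K + 1))).
  apply: (@ler_norm_sumB (fun r => I r.+1 - I r)
    (fun r => d m * g (s x m r))) => r rN.
  have [c [c1 c2 ->]] := mean_value (r%:R * d m) (r.+1%:R * d m)
    (fun y => is_derive_oriented_integral y cg).
  have dE : r.+1%:R * d m - r%:R * d m = d m by rewrite -mulrBl -natrB// subSnn mul1r.
  have cr := between_close c1 c2.
  rewrite dE in cr *; rewrite [g c * _]mulrC -mulrBr normrM gtr0_norm//.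
  rewrite ler_pM2l//; apply/ltW/hδ.
    have rK : r.+1%:R * d m <= K.
      by apply: le_trans NK; rewrite ler_pM2r// ler_nat.
    rewrite (max_idPr _) ?ler_pM2r ?ler_nat// in c2.
    rewrite (min_idPl _) ?ler_pM2r ?ler_nat// in c1.
    rewrite ger0_norm; first exact: le_trans rK.
    by apply: le_trans c1; rewrite mulr_ge0// ltW.
  have [_ sr] := rm r (steps_le (ltnW rN)).
  apply: (le_lt_trans (ler_distD (r%:R * d m) _ _)).
  rewrite [ltRHS]splitr ltr_leD//; last by rewrite distrC.
  by apply: le_lt_trans cr _; rewrite gtr0_norm.
have tele : \sum_(r < N m) (I r.+1 - I r) = I (N m).
  rewrite -(big_mkord xpredT (fun r => I r.+1 - I r)) telescope_sumr//.
  by rewrite /I mul0r oriented_integral00 subr0.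
rewrite mulr_sumr; apply: (le_trans (ler_distD (I (N m)) _ _)).
rewrite tele in H2; apply: (le_trans (lerD H1 H2)).
rewrite mulrA -[X in X + _]mul1r -mulrDl mulrA ler_pdivrMr// mulrC ler_pM2l//.
by rewrite addrC lerD2r.
Unshelve. all: by end_near. Qed.

Lemma path_bound : exists M, forall u, 0 <= u -> u <= K + 1 -> `|x u| <= M.
Proof.
have K1 : 0 <= K + 1 by rewrite addr_ge0// ltW.
have [] := @EVT_max R (fun u => `|x u|) 0 (K + 1) K1.
  by apply: continuous_subspaceT => u; apply: cvg_norm; exact: cx.
move=> c _ hc; exists `|x c| => u u0 uK.
by apply: hc; rewrite in_itv/= u0.
Qed.

Section integrands.
Variables (F f f' : R -> R).
Hypotheses (dF : forall y : R, is_derive y 1 F (f y)) (F0 : F 0 = 0).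
Hypotheses (df : forall y : R, is_derive y 1 f (f' y)) (cf' : continuous f').
Local Notation y m r := (x (s x m r)).

Lemma near_taylor_sums (ε : R) : 0 < ε -> \forall m \near \oo,
  `|F (y m (N m)) - \sum_(r < N m) f (y m r) * (y m r.+1 - y m r)
    - d m * (\sum_(r < N m) f' (y m r)) / 2| <= ε /\
  `|F (y m (N m)) - \sum_(r < N m)
      (f (y m r) + f (y m r.+1)) / 2 * (y m r.+1 - y m r)| <= ε.
Proof.
move=> e0; have [M hM] := path_bound.
(* The larger error, the trapezoidal one, is [2 * (ε / (2 * K)) * d m] per step, and
   [(N m)%:R * d m <= K]. *)
have e1 : 0 < ε / (2 * K) by rewrite divr_gt0// mulr_gt0.
have [δ δ0 hδ] := uniformly_continuous_bounded M cf' e1.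
near=> m.
have hm : 2 ^- m < δ by near: m; exact: near_step_size_lt.
(* Tolerance 1 keeps the passage times below [K + 1], the range of [path_bound]. *)
have rm : forall k : nat, k%:R <= K * 2 ^+ (2 * m) ->
    passed x m k /\ `|s x m k - k%:R * d m| <= 1 by near: m; exact: reg.
have [NK _] := steps_time m.
have yM r : (r <= N m)%N -> `|y m r| <= M.
  move=> rN; apply: hM; first exact: passage_time_ge0.
  have [_] := rm r (steps_le rN); rewrite ler_norml => /andP[_].
  rewrite lerBlDl => h; apply: (le_trans h); rewrite lerD2r.
  by apply: le_trans NK; rewrite ler_pM2r// ler_nat.
have yh r : (r < N m)%N -> `|y m r.+1 - y m r| = 2 ^- m.
  move=> rN; have [p _] := rm r.+1 (steps_le rN).
  by have [] := passage_timeS cx p.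
have yd r : (r < N m)%N -> (y m r.+1 - y m r) ^+ 2 = d m.
  by move=> /yh E; rewrite -real_normK ?num_real// E -exprVn -exprM mulnC exprVn.
have osc r : (r < N m)%N -> forall c, `|c - y m r| <= `|y m r.+1 - y m r| ->
    `|f' c - f' (y m r)| <= ε / (2 * K).
  move=> rN c; rewrite yh// => ch; rewrite distrC; apply/ltW/hδ.
    exact/yM/ltnW.
  by rewrite distrC; exact: le_lt_trans hm.
have tele : F (y m (N m)) = \sum_(r < N m) (F (y m r.+1) - F (y m r)).
  rewrite -(big_mkord xpredT (fun r => F (y m r.+1) - F (y m r))) telescope_sumr//.
  by rewrite /= x0 F0 subr0.
have NE (c : R) : 0 <= c -> c <= 2 -> (N m)%:R * (c * (ε / (2 * K)) * d m) <= ε.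
  move=> c0 c2.
  have -> : (N m)%:R * (c * (ε / (2 * K)) * d m) =
      (N m)%:R * d m * (c * (ε / (2 * K))).
    by rewrite mulrCA mulrC mulrA.
  apply: (@le_trans _ _ (K * (c * (ε / (2 * K))))).
    by rewrite ler_wpM2r// mulr_ge0// ltW.
  have -> : K * (c * (ε / (2 * K))) = (c / 2) * ε by field; rewrite gt_eqF.
  by apply: ler_piMl; [exact: ltW|rewrite ler_pdivrMr// mul1r].
split.
  have -> : d m * (\sum_(r < N m) f' (y m r)) / 2 =
      \sum_(r < N m) f' (y m r) * d m / 2.
    by rewrite mulr_sumr mulr_suml; apply: eq_bigr => r _; rewrite [d m * _]mulrC.
  rewrite tele -addrA -opprD -big_split/=.
  apply: (le_trans (@ler_norm_sumB (fun r => F (y m r.+1) - F (y m r))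
    (fun r => f (y m r) * (y m r.+1 - y m r) + f' (y m r) * d m / 2) _
    (1 * (ε / (2 * K)) * d m) _)) (NE 1 _ _) => //.
    move=> r rN; rewrite mul1r -(yd r rN) opprD addrA.
    by apply: taylor2 (dF) (df) _; exact: osc.
  by rewrite ler1n.
rewrite tele.
apply: (le_trans (@ler_norm_sumB (fun r => F (y m r.+1) - F (y m r))
  (fun r => (f (y m r) + f (y m r.+1)) / 2 * (y m r.+1 - y m r)) _
  (2 * (ε / (2 * K)) * d m) _)) (NE 2 _ _) => //.
move=> r rN; rewrite -(yd r rN).
by apply: taylor2_trapezoid (dF) (df) _; exact: osc.
Unshelve. all: by end_near. Qed.

Lemma near_last_passage (ε : R) : 0 < ε ->
  \forall m \near \oo, `|F (x K) - F (y m (N m))| <= ε.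
Proof.
move=> e0.
have cF : continuous (F \o x).
  move=> u; apply: continuous_comp; first exact: cx.
  apply: differentiable_continuous; apply/derivable1_diffP.
  by case: (dF (x u)).
have [δ δ0 hδ] := uniformly_continuous_bounded K cF e0.
have δ2 : 0 < δ / 2 by rewrite divr_gt0.
near=> m.
have dδ : d m < δ / 2 by near: m; exact: near_mesh_lt.
have rm : forall k : nat, k%:R <= K * 2 ^+ (2 * m) ->
    passed x m k /\ `|s x m k - k%:R * d m| <= δ / 2 by near: m; exact: reg.
have [_ KN] := steps_time m.
have [_ sN] := rm _ (steps_le (leqnn _)).
apply/ltW/hδ; first by rewrite gtr0_norm.
apply: (le_lt_trans (ler_distD ((N m)%:R * d m) _ _)).
rewrite [ltRHS]splitr ltr_leD//; last by rewrite distrC.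
exact: le_lt_trans dδ.
Unshelve. all: by end_near. Qed.

Lemma cvg_ito_sum : ito_sum f x K @ \oo -->
  F (x K) - 2^-1 * oriented_integral (f' \o x) 0 K.
Proof.
apply/cvgrPdist_le => ε e0.
have e3 : 0 < ε / 3 by rewrite divr_gt0.
have cg : continuous (f' \o x).
  by move=> u; apply: continuous_comp; [exact: cx|exact: cf'].
have := near_taylor_sums e3; have := near_last_passage e3.
have := riemann_sum_passage_times cg e3.
apply: filterS3 => m; rewrite /ito_sum big_add1 big_mkord/=.
set S1 := \sum_(r < _) _; set S2 := \sum_(r < _) _; set S3 := \sum_(r < _) _.
rewrite !ler_norml => /andP[h1 h2] /andP[h3 h4] [/andP[h5 h6] _].
by apply/andP; split; lra.
Qed.

Lemma cvg_stratonovich_sum : stratonovich_sum f x K @ \oo --> F (x K).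
Proof.
apply/cvgrPdist_le => ε e0.
have e2 : 0 < ε / 2 by rewrite divr_gt0.
have := near_taylor_sums e2; have := near_last_passage e2.
apply: filterS2 => m; rewrite /stratonovich_sum big_add1 big_mkord/=.
move=> h1 [_ h2]; apply: (le_trans (ler_distD (F (y m (N m))) _ _)).
by rewrite [leRHS]splitr lerD.
Qed.

End integrands.
End pathwise_convergence.

(** * Gaussian moments *)

Section gaussian_moments.
Context {R : realType}.
Local Notation mu := (@lebesgue_measure R).
Implicit Types s g x δ : R.

(** The Radon-Nikodym derivative of [normal_prob] agrees almost everywhere with [normal_pdf], both
    having the same integral over every measurable set. *)
Lemma ge0_integral_normal_prob (σ : R) (f : R -> \bar R) :
  measurable_fun setT f -> (forall x, (0 <= f x)%E) ->
  (\int[normal_prob 0%R σ]_x f x = \int[mu]_x (f x * (normal_pdf 0%R σ x)%:E))%E.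
Proof.
move=> mf f0.
have dom := normal_prob_dominates 0%R σ.
rewrite -(Radon_Nikodym_SigmaFinite.change_of_variables dom f0)//.
have idom := Radon_Nikodym_SigmaFinite.f_integrable dom.
apply: ae_eq_integral => //.
- by apply: emeasurable_funM => //; exact: measurable_int idom.
- by apply: emeasurable_funM => //; apply/measurable_EFinP;
    exact: measurable_normal_pdf.
- apply: ae_eqe_mul2l; apply: integral_ae_eq => //.
  + by apply/measurable_EFinP; exact: measurable_normal_pdf.
  + by move=> E _ mE; rewrite -Radon_Nikodym_SigmaFinite.f_integral.
Qed.

Lemma normal_pdf_sqrt δ x : 0 < δ -> normal_pdf 0 (Num.sqrt δ) x =
  normal_peak (Num.sqrt δ) * expR (- (x ^+ 2 / (2 * δ))).
Proof.
move=> d0; rewrite normal_pdfE ?gt_eqF ?sqrtr_gt0//.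
rewrite /normal_fun sqr_sqrtr ?ltW// subr0; congr (_ * expR _).
by rewrite mulNr -mulr_natl.
Qed.

(** Half of the Gaussian exponent absorbs the quartic: for [y = x ^+ 2 / (4 * δ)] one has
    [x ^+ 4 = 16 * δ ^+ 2 * y ^+ 2] and [1 + y ^+ 2 / 2 <= expR y]. What remains is a multiple of
    the density of variance [2 * δ], hence integrable. *)
Lemma quartic_normal_pdf_le δ : 0 < δ -> exists2 C, 0 <= C & forall x,
  (1 + x ^+ 4) * normal_pdf 0 (Num.sqrt δ) x <= C * expR (- (x ^+ 2 / (4 * δ))).
Proof.
move=> d0; set k := normal_peak (Num.sqrt δ).
have k0 : 0 <= k by exact: normal_peak_ge0.
exists ((1 + 32 * δ ^+ 2) * k).
  by rewrite mulr_ge0// addr_ge0// mulr_ge0// sqr_ge0.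
move=> x; rewrite normal_pdf_sqrt// -/k; set y := x ^+ 2 / (4 * δ).
have y0 : 0 <= y by rewrite divr_ge0 ?sqr_ge0// mulr_ge0// ltW.
have -> : - (x ^+ 2 / (2 * δ)) = - y + - y.
  by rewrite /y; field; rewrite gt_eqF.
have x4 : x ^+ 4 = 16 * δ ^+ 2 * y ^+ 2 by rewrite /y; field; rewrite gt_eqF.
have ey : 1 + y ^+ 2 / 2 <= expR y by have := expR_ge1Dxn 1 y0.
rewrite expRD mulrA [_ * k]mulrC mulrA [(1 + _ ) * k]mulrC.
rewrite ler_pM2r ?expR_gt0// -!mulrA ler_wpM2l//.
have h : 1 + x ^+ 4 <= (1 + 32 * δ ^+ 2) * expR y.
  apply: (@le_trans _ _ ((1 + 32 * δ ^+ 2) * (1 + y ^+ 2 / 2))).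
    rewrite x4; have : 0 <= y ^+ 2 by rewrite sqr_ge0.
    have : 0 <= δ ^+ 2 by rewrite sqr_ge0.
    by nra.
  by rewrite ler_wpM2l// addr_ge0// mulr_ge0// sqr_ge0.
by rewrite expRN ler_pdivrMr ?expR_gt0.
Qed.

Lemma integrable_quartic_normal_pdf δ (q : R -> R) A : 0 < δ ->
  measurable_fun setT q -> (forall x, `|q x| <= A * (1 + x ^+ 4)) ->
  mu.-integrable setT (fun x => (q x * normal_pdf 0 (Num.sqrt δ) x)%:E).
Proof.
move=> d0 mq qA; have [C C0 hC] := quartic_normal_pdf_le d0.
have A0 : 0 <= A.
  by have := le_trans (normr_ge0 _) (qA 0); rewrite expr0n/= addr0 mulr1.
have d2 : 0 < 2 * δ by rewrite mulr_gt0.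
set k := normal_peak (Num.sqrt (2 * δ)).
have k0 : 0 < k by rewrite normal_peak_gt0// gt_eqF// sqrtr_gt0.
pose B := A * C / k.
apply: (@le_integrable _ _ _ mu setT _ _
  (fun x => B%:E * (normal_pdf 0 (Num.sqrt (2 * δ)) x)%:E)%E) => //.
- apply/measurable_EFinP/measurable_funM => //; exact: measurable_normal_pdf.
- move=> x _; rewrite !abse_EFin lee_fin.
  rewrite [leRHS]ger0_norm; last first.
    by rewrite mulr_ge0 ?normal_pdf_ge0// !mulr_ge0// invr_ge0 ltW.
  rewrite normrM [X in _ * X <= _]ger0_norm ?normal_pdf_ge0//.
  apply: (@le_trans _ _ (A * ((1 + x ^+ 4) * normal_pdf 0 (Num.sqrt δ) x))).
    by rewrite mulrA ler_wpM2r ?normal_pdf_ge0.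
  rewrite [normal_pdf 0 (Num.sqrt (2 * δ)) x]normal_pdf_sqrt// -/k.
  rewrite (_ : B * _ = A * (C * expR (- (x ^+ 2 / (4 * δ))))) ?ler_wpM2l//.
  rewrite (_ : 2 * (2 * δ) = 4 * δ); last by ring.
  by rewrite /B; field; rewrite gt_eqF.
- by apply: integrableZl => //; exact: integrable_normal_pdf.
Qed.


(** Moments by integration by parts: [G'] is the derivative of [G] and integrates to 0. The
    coefficients [a], [b], [c] give access to the moments of order 1, 2 and 4. *)
Let G (a b c δ x : R) := (a + b * x + c * x ^+ 3) * normal_pdf 0 (Num.sqrt δ) x.
Let G' (a b c δ x : R) := (b + 3 * c * x ^+ 2 -
  (a * x + b * x ^+ 2 + c * x ^+ 4) / δ) * normal_pdf 0 (Num.sqrt δ) x.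

Lemma is_derive_cubic_normal_pdf (a b c δ x : R) : 0 < δ ->
  is_derive x 1 (G a b c δ) (G' a b c δ x).
Proof.
move=> d0; rewrite (_ : G a b c δ = fun x : R => (a + b * x + c * x ^+ 3) *
  (normal_peak (Num.sqrt δ) * expR (- (x ^+ 2 / (2 * δ))))); last first.
  by apply/funext => y; rewrite /G normal_pdf_sqrt.
rewrite /G' normal_pdf_sqrt//.
apply: is_derive_eq.
rewrite /GRing.scale/=; field.
by rewrite gt_eqF.
Qed.

Lemma continuous_cubic_normal_pdf' (a b c δ : R) : 0 < δ ->
  continuous (G' a b c δ).
Proof.
move=> d0 x; apply: cvgM; last first.
  by apply: continuous_normal_pdf; rewrite gt_eqF// sqrtr_gt0.
suff : {for x, continuous (fun x : R =>
    b + 3 * c * x ^+ 2 - (a * x + b * x ^+ 2 + c * x ^+ 4) / δ)} by [].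
by apply: differentiable_continuous; apply/derivable1_diffP; exact: ex_derive.
Qed.

Lemma cubic_bound (a b c δ : R) : exists A, forall x,
  `|b + 3 * c * x ^+ 2 - (a * x + b * x ^+ 2 + c * x ^+ 4) / δ| <=
    A * (1 + x ^+ 4) /\ `|a + b * x + c * x ^+ 3| <= A * (1 + x ^+ 4).
Proof.
pose B := `|b| + 3 * `|c| + (`|a| + `|b| + `|c|) * `|δ^-1|.
pose B' := `|a| + `|b| + `|c|.
have B0 : 0 <= B by rewrite /B !addr_ge0 ?mulr_ge0 ?addr_ge0.
have B'0 : 0 <= B' by rewrite /B' !addr_ge0.
exists (B + B') => x.
have x2 : `|x ^+ 2| <= 1 + x ^+ 4.
  by rewrite ger0_norm ?sqr_ge0//; nra.
have x40 : 0 <= x ^+ 4 by rewrite exprn_even_ge0.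
have x4 : `|x ^+ 4| <= 1 + x ^+ 4 by rewrite ger0_norm//; lra.
have nx0 := normr_ge0 x.
have nx4 : `|x| ^+ 4 = x ^+ 4 by rewrite -normrX ger0_norm.
have x1 : `|x| <= 1 + x ^+ 4.
  rewrite -nx4; have [x1|x1] := leP `|x| 1; first by nra.
  have : `|x| ^+ 1 <= `|x| ^+ 4 by rewrite ler_eXn2l.
  by rewrite expr1; lra.
have x3 : `|x ^+ 3| <= 1 + x ^+ 4.
  rewrite normrX -nx4; have [x1'|x1'] := leP `|x| 1.
    by have := exprn_ile1 3 nx0 x1'; rewrite nx4; lra.
  have : `|x| ^+ 3 <= `|x| ^+ 4 by rewrite ler_eXn2l.
  by lra.
have x0 : 1 <= 1 + x ^+ 4 by lra.
split.
  apply: (@le_trans _ _ (B * (1 + x ^+ 4))); last by rewrite ler_wpM2r ?lerDl//; lra.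
  apply: (le_trans (ler_normB _ _)); rewrite {1}/B [leRHS]mulrDl lerD//.
    apply: (le_trans (ler_normD _ _)); rewrite [leRHS]mulrDl lerD//.
      by rewrite ler_peMr.
    by rewrite normrM normrM [`|3|]ger0_norm// ler_wpM2l// mulr_ge0.
  rewrite normrM mulrAC ler_wpM2r//.
  apply: (le_trans (ler_normD _ _)); rewrite [leRHS]mulrDl lerD//.
    apply: (le_trans (ler_normD _ _)); rewrite [leRHS]mulrDl lerD//.
      by rewrite normrM ler_wpM2l.
    by rewrite normrM ler_wpM2l.
  by rewrite normrM ler_wpM2l.
apply: (@le_trans _ _ (B' * (1 + x ^+ 4))); last by rewrite ler_wpM2r ?lerDr//; lra.
apply: (le_trans (ler_normD _ _)); rewrite /B' [leRHS]mulrDl lerD//.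
  apply: (le_trans (ler_normD _ _)); rewrite [leRHS]mulrDl lerD//.
    by rewrite ler_peMr.
  by rewrite normrM ler_wpM2l.
by rewrite normrM ler_wpM2l.
Qed.

Lemma integrable_cubic_normal_pdf' (a b c δ : R) : 0 < δ ->
  mu.-integrable setT (EFin \o G' a b c δ).
Proof.
move=> d0; have [A hA] := cubic_bound a b c δ.
apply: (@integrable_quartic_normal_pdf _ _ A) => //; last first.
  by move=> x; have [] := hA x.
apply: continuous_measurable_fun => x.
by apply: differentiable_continuous; apply/derivable1_diffP; exact: ex_derive.
Qed.

(** By dominated convergence it is enough to integrate over growing symmetric intervals; there the
    integral is a difference of boundary values of [G], which tend to 0. *)
Lemma integral_cubic_normal_pdf' (a b c δ : R) : 0 < δ ->
  (\int[mu]_x (G' a b c δ x)%:E = 0)%E.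
Proof.
move=> d0; pose g n := (EFin \o G' a b c δ) \_ `[- n.+1%:R, n.+1%:R].
have iG := integrable_cubic_normal_pdf' a b c d0.
have mG := measurable_int _ iG.
have [_ _ cvgg] : [/\ mu.-integrable setT (EFin \o G' a b c δ),
  [sequence \int[mu]_x (`|g n x - (EFin \o G' a b c δ) x|)]_n @ \oo --> 0%E
  & [sequence \int[mu]_x (g n x)]_n @ \oo --> (\int[mu]_x (EFin \o G' a b c δ) x)]%E.
  apply: (dominated_convergence measurableT _ mG _ (integrable_abse iG)).
  - move=> n; apply/(measurable_restrictT _ _).1 => //.
    exact: measurable_funS mG.
  - apply: aeW => x _; apply: cvg_near_cst.
    near=> n; rewrite /g patchE ifT// inE/= in_itv/= -ler_norml.
    apply: (le_trans (ltW (truncnS_gt _))).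
    by rewrite ler_nat ltnS; near: n; exact: nbhs_infty_ge.
  - apply: aeW => x n _; rewrite /g patchE; case: ifP => // _.
    by rewrite abse0 abse_ge0.
rewrite -(cvg_lim _ cvgg)//; apply/cvg_lim => //.
have gE n : (\int[mu]_x (g n x) =
    (G a b c δ n.+1%:R - G a b c δ (- n.+1%:R))%:E)%E.
  rewrite -integral_mkcond EFinB; apply: continuous_FTC2.
  - by rewrite gtrN// ltr0n.
  - by apply: continuous_subspaceT => x; exact: continuous_cubic_normal_pdf'.
  - have cG (x : R) : {for x, continuous (G a b c δ)}.
      apply: differentiable_continuous; apply/derivable1_diffP.
      by case: (is_derive_cubic_normal_pdf a b c x d0).
    split.
    + by move=> x _; case: (is_derive_cubic_normal_pdf a b c x d0).
    + exact/cvg_at_right_filter/cG.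
    + exact/cvg_at_left_filter/cG.
  - move=> x _; rewrite derive1E.
    by case: (is_derive_cubic_normal_pdf a b c x d0).
have [A hA] := cubic_bound a b c δ.
have [C C0 hC] := quartic_normal_pdf_le d0.
have A0 : 0 <= A.
  by have [_ /(le_trans (normr_ge0 _))] := hA 0; rewrite expr0n/= addr0 mulr1.
(* [A * C] bounds polynomial times density up to the factor [expR (- u)], where
   [u = x ^+ 2 / (4 * δ)]; for [|x| = n + 1] that factor is at most [4 * δ / (n + 1)] because
   [expR u >= u]. *)
pose D := A * C * (4 * δ).
have GD (x : R) n : `|x| = n.+1%:R -> `|G a b c δ x| <= D * harmonic n.
  move=> xn; rewrite /G normrM [X in _ * X]ger0_norm ?normal_pdf_ge0//.
  have [_ h] := hA x.
  apply: (le_trans (ler_wpM2r (normal_pdf_ge0 _ _ _) h)).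
  rewrite -mulrA; apply: (le_trans (ler_wpM2l A0 (hC x))).
  rewrite mulrA /D -[leRHS]mulrA ler_wpM2l// ?mulr_ge0//.
  rewrite expRN /= (_ : 4 * δ / n.+1%:R = (n.+1%:R / (4 * δ))^-1); last first.
    by rewrite invf_div.
  rewrite lef_pV2 ?posrE ?expR_gt0 ?divr_gt0 ?mulr_gt0//.
  apply: le_trans (expR_ge1Dx _).
  rewrite -(real_normK (num_real x)) xn.
  apply: (@le_trans _ _ (n.+1%:R ^+ 2 / (4 * δ))); last by rewrite lerDr.
  by rewrite ler_pM2r ?invr_gt0 ?mulr_gt0// expr2 ler_peMr// ler1n.
apply: cvg_EFin.
  by apply: nearW => n /=; rewrite gE.
apply/norm_cvg0P.
apply: (@squeeze_cvgr _ _ _ _ (cst 0) (fun n => (2 * D) * harmonic n)).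
- near=> n; rewrite normr_ge0/= gE/=.
  apply: (le_trans (ler_normB _ _)); rewrite -mulrA mulr_natl mulr2n.
  by rewrite lerD// GD// ?normrN ger0_norm.
- exact: cvg_cst.
- by rewrite -[X in _ --> X](mulr0 (2 * D)); apply: cvgMr; exact: cvg_harmonic.
Unshelve. all: by end_near. Qed.

Lemma integral_normal_prob_cubic (a b c C δ : R) : 0 < δ ->
  let h x := b + 3 * c * x ^+ 2 - (a * x + b * x ^+ 2 + c * x ^+ 4) / δ + C in
  (forall x, 0 <= h x) ->
  (\int[normal_prob 0%R (Num.sqrt δ)]_x (h x)%:E = C%:E)%E.
Proof.
move=> d0 h h0; rewrite ge0_integral_normal_prob//; last first.
  apply/measurable_EFinP; apply: continuous_measurable_fun => x.
  by apply: differentiable_continuous; apply/derivable1_diffP; exact: ex_derive.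
have iG := integrable_cubic_normal_pdf' a b c d0.
transitivity (\int[mu]_x ((EFin \o G' a b c δ) x +
    C%:E * (normal_pdf 0 (Num.sqrt δ) x)%:E))%E.
  by apply: eq_integral => x _; rewrite /= -!EFinM -EFinD /h mulrDl.
have ip : mu.-integrable setT (fun x => C%:E * (normal_pdf 0 (Num.sqrt δ) x)%:E)%E.
  by apply: integrableZl => //; exact: integrable_normal_pdf.
rewrite integralD// [X in (X + _)%E]integral_cubic_normal_pdf'// add0e.
rewrite integralZl ?integral_normal_pdf ?mule1//.
exact: integrable_normal_pdf.
Qed.

Lemma integral_normal_prob_affine_sqr (s g δ : R) : 0 < δ ->
  (\int[normal_prob 0%R (Num.sqrt δ)]_x ((s + g * x) ^+ 2)%:E =
   (s ^+ 2 + g ^+ 2 * δ)%:E)%E.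
Proof.
move=> d0.
(* The coefficients come from matching powers of [x], the constant [C] being the expected second
   moment; likewise in the next lemma. *)
rewrite -(@integral_normal_prob_cubic (- (2 * s * g * δ)) (- (g ^+ 2 * δ)) 0
  (s ^+ 2 + g ^+ 2 * δ) δ)//; last first.
  move=> x; rewrite [leRHS](_ : _ = (s + g * x) ^+ 2) ?sqr_ge0//.
  by field; rewrite gt_eqF.
by apply: eq_integral => x _; congr EFin; field; rewrite gt_eqF.
Qed.

Lemma integral_normal_prob_sqr_sub_sqr (s δ : R) : 0 < δ ->
  (\int[normal_prob 0%R (Num.sqrt δ)]_x ((s + (x ^+ 2 - δ)) ^+ 2)%:E =
   (s ^+ 2 + 2 * δ ^+ 2)%:E)%E.
Proof.
move=> d0.
rewrite -(@integral_normal_prob_cubic 0 (- (2 * s * δ) - δ ^+ 2) (- δ)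
  (s ^+ 2 + 2 * δ ^+ 2) δ)//; last first.
  move=> x; rewrite [leRHS](_ : _ = (s + (x ^+ 2 - δ)) ^+ 2) ?sqr_ge0//.
  by field; rewrite gt_eqF.
by apply: eq_integral => x _; congr EFin; field; rewrite gt_eqF.
Qed.

End gaussian_moments.

(** * Independence and Tonelli *)

Section independent_tonelli.
Context {R : realType} {d : measure_display} {T : measurableType d}.
Variables (P : probability T R) (G : set (set T)) (X : {RV P >-> R}).
Hypotheses (Gm : G `<=` measurable) (setIG : setI_closed G) (GT : G setT).
Hypothesis indep : forall A B, G A -> measurable B ->
  (P (A `&` X @^-1` B) = P A * P (X @^-1` B))%E.

(** For fixed [B] both sides are finite measures in [A] that agree on the π-system [G]. *)
Lemma independent_g_sigma_algebra A B : <<s G >> A -> measurable B ->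
  (P (A `&` X @^-1` B) = P A * P (X @^-1` B))%E.
Proof.
move=> sGA mB.
have mXB : measurable (X @^-1` B) by exact: measurable_sfunP.
have c0 : 0 <= fine (P (X @^-1` B)) by exact: fine_ge0.
pose c : {nonneg R} := NngNum c0.
have PXB : P (X @^-1` B) = (c%:num)%:E.
  by rewrite /= fineK// fin_num_measure.
rewrite PXB muleC.
apply: (g_sigma_algebra_measure_unique G Gm (fun=> setT) (fun=> GT) _
  (mrestr P mXB) (mscale c P) setIG _ _ _ sGA) => //=.
- by rewrite bigcup_const.
- by move=> A' GA'; rewrite /mrestr /mscale/= -PXB muleC; exact: indep.
- by move=> _; rewrite /mrestr setTI (le_lt_trans (probability_le1 P mXB))// ltry.
Qed.

Local Notation TG := (g_sigma_algebraType G).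

Lemma measurable_id_g_sigma_algebra : measurable_fun [set: T] (id : T -> TG).
Proof.
move=> _ A mA; rewrite setTI preimage_id.
exact: (smallest_sub (@sigma_algebra_measurable _ T) Gm).
Qed.

Lemma measurable_fun_g_sigma_algebra d' (U : measurableType d') (f : T -> U) :
  measurable_fun [set: TG] (f : TG -> U) -> measurable_fun [set: T] f.
Proof.
by move=> mf; exact: (measurableT_comp mf measurable_id_g_sigma_algebra).
Qed.

(** With [T] carrying the coarser σ-algebra generated by [G], independence makes the law of
    [(w, X w)] a product measure. Thus [X] may be integrated out with the past frozen, which does
    the work of a conditional expectation. *)
Lemma independent_tonelli (f : TG * R -> \bar R) :
  measurable_fun setT f -> (forall z, (0 <= f z)%E) ->
  (\int[P]_w f (w, X w) = \int[P]_w \int[distribution P X]_x f (w, x))%E.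
Proof.
move=> mf f0.
pose iG : {mfun T >-> TG} :=
  HB.pack (id : T -> TG) (isMeasurableFun.Build _ _ _ _ _
    measurable_id_g_sigma_algebra).
have mpair : measurable_fun setT (fun w : T => (w : TG, X w)).
  by apply: measurable_fun_pair => //; exact: measurable_id_g_sigma_algebra.
pose pG : {mfun T >-> (TG * R)%type} :=
  HB.pack (fun w : T => (w : TG, X w)) (isMeasurableFun.Build _ _ _ _ _ mpair).
transitivity (\int[distribution P pG]_z f z)%E.
  by rewrite ge0_integral_distribution.
transitivity (\int[distribution P iG \x distribution P X]_z f z)%E.
  apply: eq_measure_integral => A mA _; apply/esym.
  apply: product_measure_unique => // B C mB mC.
  by rewrite /distribution /pushforward/= -independent_g_sigma_algebra.
rewrite fubini_tonelli1// ge0_integral_distribution//.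
- exact: measurable_fun_fubini_tonelli_F.
- by move=> w; apply: integral_ge0.
Qed.

End independent_tonelli.

(* [normal_prob] lives on [measurableTypeR R], whose display differs from the
   canonical one of [R]; the two integrals are compared through pushforwards. *)
Lemma ge0_integral_distribution_normal {R : realType} {d : measure_display}
    {T : measurableType d} (P : probability T R) (X : {RV P >-> R}) (σ : R)
    (f : R -> \bar R) :
  measurable_fun setT f -> (forall x, (0 <= f x)%E) ->
  (forall B, measurable B -> distribution P X B = normal_prob 0 σ B) ->
  (\int[distribution P X]_x f x = \int[normal_prob 0%R σ]_x f x)%E.
Proof.
move=> mf f0 XN; rewrite ge0_integral_distribution//.
have mX : measurable_fun setT (X : T -> measurableTypeR R).
  by move=> _ B mB; rewrite setTI; exact: measurable_sfunP.
pose X' : {mfun T >-> measurableTypeR R} :=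
  HB.pack (X : T -> measurableTypeR R) (isMeasurableFun.Build _ _ _ _ _ mX).
transitivity (\int[distribution P X']_x f x)%E.
  by rewrite ge0_integral_distribution.
by apply: eq_measure_integral => A mA _; exact: XN.
Qed.

(** * Second moments of sums driven by Gaussian increments *)

Section gaussian_increments.
Context {R : realType} {d : measure_display} {T : measurableType d}.
Variables (P : probability T R) (ξ : nat -> {RV P >-> R}) (δ : R).
Hypothesis δ0 : 0 < δ.
Hypothesis indep : forall k (B : nat -> set R), (forall i, measurable (B i)) ->
  (P (\bigcap_(i in `I_k.+1) (ξ i @^-1` B i)) =
   P (\bigcap_(i in `I_k) (ξ i @^-1` B i)) * P (ξ k @^-1` B k))%E.
Hypothesis normal : forall k B, measurable B ->
  distribution P (ξ k) B = normal_prob 0 (Num.sqrt δ) B.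

(** Rectangles rather than the whole σ-algebra of the first [k] increments: they form a π-system,
    and independence is given on them. *)
Definition past k : set (set T) :=
  [set A | exists2 B : nat -> set R, forall i, measurable (B i) &
    A = \bigcap_(i in `I_k) (ξ i @^-1` B i)].

Local Notation Tpast k := (g_sigma_algebraType (past k)).

Lemma past_measurable k : past k `<=` measurable.
Proof.
move=> _ [B mB ->]; rewrite bigcap_mkord; apply: bigsetI_measurable => i _.
exact: measurable_sfunP.
Qed.

Lemma past_setI k : setI_closed (past k).
Proof.
move=> _ _ [B mB ->] [C mC ->]; exists (fun i => B i `&` C i).
  by move=> i; exact: measurableI.
by rewrite -bigcapI; apply: eq_bigcapr => i _; rewrite preimage_setI.
Qed.

Lemma pastT k : past k setT.
Proof.
exists (fun=> setT) => //; apply/esym; rewrite -subTset => x _ i _ //.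
Qed.

Lemma measurable_past i k : (i < k)%N ->
  measurable_fun [set: Tpast k] (ξ i : Tpast k -> R).
Proof.
move=> ik _ B mB; rewrite setTI; apply: sub_sigma_algebra.
exists (fun j => if j == i then B else setT) => [j|]; first by case: ifP.
apply/seteqP; split => [x xB j jk /=|x /(_ i ik)]; last by rewrite /= eqxx.
by case: eqVneq => // ->.
Qed.

Lemma second_moment_step k (φ : T -> R -> R) :
  measurable_fun [set: Tpast k * R] (fun z => φ z.1 z.2) ->
  (\int[P]_w ((φ w (ξ k w)) ^+ 2)%:E =
   \int[P]_w \int[normal_prob 0%R (Num.sqrt δ)]_x ((φ w x) ^+ 2)%:E)%E.
Proof.
move=> mφ.
have ind A B : past k A -> measurable B ->
    (P (A `&` ξ k @^-1` B) = P A * P (ξ k @^-1` B))%E.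
  move=> [C mC ->] mB.
  have := indep k (B := fun i => if i == k then B else C i).
  rewrite eqxx (_ : \bigcap_(i in `I_k.+1) _ =
    \bigcap_(i in `I_k) (ξ i @^-1` C i) `&` ξ k @^-1` B); last first.
    rewrite !bigcap_mkord big_ord_recr/= eqxx; congr (_ `&` _).
    by apply: eq_bigr => i _; rewrite ltn_eqF.
  rewrite (_ : \bigcap_(i in `I_k) _ = \bigcap_(i in `I_k) (ξ i @^-1` C i)).
    by apply=> i; case: ifP.
  by apply: eq_bigcapr => i /= ik; rewrite ltn_eqF.
have := @independent_tonelli _ _ _ P (past k) (ξ k) (@past_measurable k)
  (@past_setI k) (pastT k) ind (fun z => ((φ z.1 z.2) ^+ 2)%:E).
move=> ->.
- apply: eq_integral => w _.
  apply: ge0_integral_distribution_normal => //; last exact: normal.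
  + apply/measurable_EFinP/measurable_funX.
    exact: (measurableT_comp mφ (@pair1_measurable _ _ (Tpast k) R w)).
  + by move=> x; rewrite lee_fin sqr_ge0.
- by apply/measurable_EFinP/measurable_funX.
- by move=> z; rewrite lee_fin sqr_ge0.
Qed.

(** Orthogonality of martingale differences in recursive form: by [hφ], integrating out the fresh
    increment [ξ k] adds at most [c] to the second moment, so no cross terms need to be expanded. *)
Lemma second_moment_le (S : nat -> T -> R) (φ : nat -> T -> R -> R) (c : R) :
  0 <= c -> (forall w, S 0%N w = 0) ->
  (forall k, measurable_fun setT (S k)) ->
  (forall k w, S k.+1 w = φ k w (ξ k w)) ->
  (forall k, measurable_fun [set: Tpast k * R] (fun z => φ k z.1 z.2)) ->
  (forall k w, (\int[normal_prob 0%R (Num.sqrt δ)]_x ((φ k w x) ^+ 2)%:E <=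
    (S k w ^+ 2 + c)%:E)%E) ->
  forall k, (\int[P]_w (S k w ^+ 2)%:E <= (k%:R * c)%:E)%E.
Proof.
move=> c0 S0 mS SE mφ hφ; elim=> [|k IH].
  by under eq_integral do rewrite S0 expr0n/=; rewrite integral0 mul0r.
under eq_integral do rewrite SE.
rewrite second_moment_step//.
apply: (@le_trans _ _ (\int[P]_w (S k w ^+ 2 + c)%:E)%E).
  apply: ge0_le_integral => //.
  - by move=> w _; apply: integral_ge0 => x _; rewrite lee_fin sqr_ge0.
  - apply: (measurable_fun_g_sigma_algebra (@past_measurable k)).
    have mφ2 := measurable_funX 2 (mφ k).
    (* For measurability the inner integral is read as Tonelli's partial integral under the law of
       [ξ k]. *)
    rewrite (_ : (fun w => _) =
        fubini_F (distribution P (ξ k)) (fun z => (φ k z.1 z.2 ^+ 2)%:E)).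
      apply: (@measurable_fun_fubini_tonelli_F _ _ (Tpast k)).
      + exact/measurable_EFinP.
      + by move=> z; rewrite lee_fin sqr_ge0.
    apply/funext => w; rewrite /fubini_F/=; apply/esym.
    apply: ge0_integral_distribution_normal => //; last exact: normal.
    + apply/measurable_EFinP.
      exact: (measurableT_comp mφ2 (@pair1_measurable _ _ (Tpast k) R w)).
    + by move=> x; rewrite lee_fin sqr_ge0.
  - apply/measurable_EFinP/measurable_funD => //; exact: measurable_funX.
under eq_integral do rewrite EFinD.
rewrite ge0_integralD//.
- rewrite integral_cst//= probability_setT mule1 -natr1 mulrDl mul1r EFinD.
  by rewrite leeD.
- by move=> w _; rewrite lee_fin sqr_ge0.
- by apply/measurable_EFinP/measurable_funX.
Qed.

Lemma measurable_past_sum (g : nat -> T -> R) (F : R -> R -> R) i k :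
  (i <= k)%N -> measurable_fun setT (fun z => F z.1 z.2) ->
  (forall j, (j < i)%N -> measurable_fun [set: Tpast k] (g j : Tpast k -> R)) ->
  measurable_fun [set: Tpast k]
    ((fun w => \sum_(j < i) F (g j w) (ξ j w)) : Tpast k -> R).
Proof.
move=> ik mF mg; apply: measurable_sum => j.
apply: (measurableT_comp mF (measurable_fun_pair _ _)); first exact: mg.
by apply: measurable_past; exact: leq_trans ik.
Qed.

Lemma second_moment_transform (g : nat -> T -> R) (h : R) :
  (forall j k, (j <= k)%N -> measurable_fun [set: Tpast k] (g j : Tpast k -> R)) ->
  (forall k w, `|g k w| <= h) -> forall k,
  (\int[P]_w ((\sum_(i < k) g i w * ξ i w) ^+ 2)%:E <= (k%:R * (h ^+ 2 * δ))%:E)%E.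
Proof.
move=> mg gh.
have mS k : measurable_fun [set: Tpast k]
    ((fun w => \sum_(i < k) g i w * ξ i w) : Tpast k -> R).
  apply: (@measurable_past_sum g (fun x y => x * y)) => //.
    exact: measurable_funM.
  by move=> j jk; apply: mg; exact: ltnW.
apply: (@second_moment_le _ (fun k w x => \sum_(i < k) g i w * ξ i w + g k w * x)).
- by rewrite mulr_ge0 ?sqr_ge0 ?ltW.
- by move=> w; rewrite big_ord0.
- by move=> k; exact: (measurable_fun_g_sigma_algebra (@past_measurable k)) (mS k).
- by move=> k w; rewrite big_ord_recr.
- move=> k; apply: measurable_funD; first
    exact: (measurableT_comp (mS k) (@measurable_fst _ _ (Tpast k) R)).
  apply: measurable_funM => //.
  exact: (measurableT_comp (mg _ _ (leqnn k)) (@measurable_fst _ _ (Tpast k) R)).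
- move=> k w; rewrite integral_normal_prob_affine_sqr// lee_fin lerD2l.
  apply: ler_wpM2r; [exact: ltW|rewrite -(real_normK (num_real (g k w)))].
  have h0 : 0 <= h := le_trans (normr_ge0 _) (gh k w).
  by rewrite ler_pXn2r ?nnegrE ?normr_ge0//.
Qed.

Lemma second_moment_quadratic_variation k :
  (\int[P]_w ((\sum_(i < k) (ξ i w ^+ 2 - δ)) ^+ 2)%:E <=
    (k%:R * (2 * δ ^+ 2))%:E)%E.
Proof.
have mS n : measurable_fun [set: Tpast n]
    ((fun w => \sum_(i < n) (ξ i w ^+ 2 - δ)) : Tpast n -> R).
  apply: (@measurable_past_sum (fun=> cst 0) (fun x y => y ^+ 2 - δ)) => //.
  by apply: measurable_funB => //; exact: measurable_funX.
apply: (@second_moment_le (fun n w => \sum_(i < n) (ξ i w ^+ 2 - δ))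
   (fun n w x => \sum_(i < n) (ξ i w ^+ 2 - δ) + (x ^+ 2 - δ))).
- by rewrite mulr_ge0 ?sqr_ge0.
- by move=> w; rewrite big_ord0.
- by move=> n; exact: (measurable_fun_g_sigma_algebra (@past_measurable n)) (mS n).
- by move=> n w; rewrite big_ord_recr.
- move=> n; apply: measurable_funD; first
    exact: (measurableT_comp (mS n) (@measurable_fst _ _ (Tpast n) R)).
  by apply: measurable_funB => //; exact: measurable_funX.
- by move=> n w; rewrite integral_normal_prob_sqr_sub_sqr.
Qed.

End gaussian_increments.

(** * A Borel-Cantelli argument *)

Section infinitely_often_small.
Context {R : realType} {d : measure_display} {T : measurableType d}.
Variable P : probability T R.

Lemma markov_ge0 (Z : T -> R) (a b : R) : measurable_fun setT Z ->
  (forall w, 0 <= Z w) -> 0 < a -> (\int[P]_w (Z w)%:E <= b%:E)%E ->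
  (P [set w | (a <= Z w)%R] <= (b / a)%:E)%E.
Proof.
move=> mZ Z0 a0 Zb.
have mEZ : measurable_fun setT (EFin \o Z) by exact/measurable_EFinP.
have h := @le_integral_comp_abse _ T R P setT measurableT (EFin \o Z) a id
  (@measurable_id _ _ _) (fun r r0 => r0) (fun x y _ _ xy => xy) mEZ a0.
have E : setT `&` [set x | (`|(EFin \o Z) x| >= a%:E)%E] = [set w | a <= Z w].
  by rewrite setTI; apply/seteqP; split => w /=; rewrite lee_fin ger0_norm.
rewrite E in h.
rewrite EFinM muleC lee_pdivlMl//; apply: (le_trans h); apply: le_trans Zb.
rewrite le_eqVlt; apply/orP; left; apply/eqP.
by apply: eq_integral => w _; rewrite /= ger0_norm.
Qed.

(** The bound is uniform in [n], not summable. Still, the event that [Z m n] is large for all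
    [n >= n0] lies in the single event [B m n0], so by Markov and monotone limits [A m] has
    probability at most [C * 2 ^- m]. This is summable in [m]. *)
Lemma ae_infinitely_often_small (Z : nat -> nat -> T -> R) (C : R) :
  (forall m n, measurable_fun setT (Z m n)) -> (forall m n w, 0 <= Z m n w) ->
  (forall m n, (\int[P]_w (Z m n w)%:E <= (C * (2 ^- m) ^+ 2)%:E)%E) ->
  {ae P, forall w, \forall m \near \oo, forall n0, exists2 n, (n0 <= n)%N &
     Z m n w < 2 ^- m}.
Proof.
move=> mZ Z0 ZC.
pose B m n := [set w | 2 ^- m <= Z m n w].
have mB m n : measurable (B m n).
  have := emeasurable_fun_c_infty measurableT
    ((measurable_EFinP _ _).2 (mZ m n)) (2 ^- m)%:E.
  by rewrite setTI.
pose A m := \bigcup_n0 \bigcap_(n in [set n | (n0 <= n)%N]) B m n.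
have mA' m n0 : measurable (\bigcap_(n in [set n | (n0 <= n)%N]) B m n).
  by apply: bigcap_measurableType => n _; exact: mB.
have mA m : measurable (A m) by exact: bigcup_measurable.
have PA m : (P (A m) <= ((2 * C) / (2 ^ (m + 1))%:R)%:E)%E.
  have cvgA := @nondecreasing_cvg_mu _ _ _ P
    (fun n0 => \bigcap_(n in [set n | (n0 <= n)%N]) B m n) (mA' m) (mA m) _.
  have /cvgA{}cvgA : nondecreasing_seq
      (fun n0 => \bigcap_(n in [set n | (n0 <= n)%N]) B m n).
    move=> i j ij; apply/subsetPset => w Bw n /= jn; apply: Bw => /=.
    exact: leq_trans ij jn.
  rewrite -(cvg_lim _ cvgA)//; apply: lime_le.
    by apply/cvg_ex; eexists; exact: cvgA.
  apply: nearW => n0; apply: (@le_trans _ _ (P (B m n0))).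
    apply: le_measure; rewrite ?inE//.
    by move=> w; apply => /=.
  apply: (le_trans (markov_ge0 (mZ m n0) (Z0 m n0) _ (ZC m n0))).
    by rewrite invr_gt0 exprn_gt0.
  rewrite lee_fin natrX exprD expr1 invfM le_eqVlt; apply/orP; left; apply/eqP.
  by field; rewrite expf_neq0.
have limA : P (lim_sup_set A) = 0%E.
  apply: lim_sup_set_cvg0 => //.
  apply: (@le_lt_trans _ _ (\sum_(m <oo) ((2 * C) / (2 ^ (m + 1))%:R)%:E)%E).
    by apply: lee_nneseries => // m _; exact: PA.
  have := @cvg_geometric_eseries_half R (2 * C) 0%N.
  by move=> /cvg_lim -> //; rewrite ltry.
exists (lim_sup_set A); split => //.
  by apply: bigcap_measurableType => n _; exact: bigcup_measurable.
move=> w /= nw n _; apply: contrapT => nA; apply: nw.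
exists n => // m /= nm n0; apply: contrapT => nZ; apply: nA.
exists m => //=; exists n0 => // k /= n0k.
by rewrite /B /= leNgt; apply/negP => Zk; apply: nZ; exists k.
Qed.

End infinitely_often_small.

(** * Tracking a Wiener process *)

Section discrepancy.
Context {R : realType}.
Implicit Types (h e t : R) (v : nat -> R) (N : nat).

(** Makes the integrand of [tracking_sum] bounded on every path, as the second moment bound needs;
    on paths with small oscillation it changes nothing. *)
Definition clamp h (z : R) : R := Num.max (- h) (Num.min h z).

Lemma clamp_le h z : 0 <= h -> `|clamp h z| <= h.
Proof.
move=> h0; rewrite ler_norml /clamp le_max lexx/= ge_max ge_min lexx/= andbT.
by rewrite (le_trans _ h0)// oppr_le0.
Qed.

Lemma clamp_id h z : `|z| <= h -> clamp h z = z.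
Proof.
by rewrite ler_norml => /andP[z1 z2]; rewrite /clamp (min_idPr z2) (max_idPr z1).
Qed.

Definition tracking_sum h e v N : R :=
  \sum_(i < N) clamp h (v i - tracker h e v i) * (v i.+1 - v i).

Definition quadratic_variation v N : R := \sum_(i < N) (v i.+1 - v i) ^+ 2.

(** With mesh [t / N] the squared deviation of the quadratic variation has mean at most
    [2 * t ^+ 2 / N]. The weight [N h ^+ 2] brings it to the order [h ^+ 2] of the first term,
    uniformly in [N], and is at least 1 on fine meshes, so a single Markov bound controls both. *)
Definition discrepancy t h e v N : R := tracking_sum h e v N ^+ 2 +
  (N%:R * h ^+ 2) * (quadratic_variation v N - t) ^+ 2.

Lemma discrepancy_ge0 t h e v N : 0 <= discrepancy t h e v N.
Proof.
apply: addr_ge0; first exact: sqr_ge0.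
by apply: mulr_ge0; [apply: mulr_ge0; rewrite ?sqr_ge0|exact: sqr_ge0].
Qed.

Lemma measurable_tracker d (X : measurableType d) h e (v : nat -> X -> R) i :
  (forall j, (j <= i)%N -> measurable_fun setT (v j)) ->
  measurable_fun setT (fun z => tracker h e (v ^~ z) i).
Proof.
elim: i => [|i IH] mv /=; first exact: measurable_cst.
have mi : measurable_fun setT (fun z => tracker h e (v ^~ z) i).
  by apply: IH => j ji; apply: mv; exact: leqW.
have ms := mv i.+1 (leqnn _).
apply: measurable_fun_ifT => //.
- by apply: measurable_fun_ler => //; exact: measurable_funD.
- exact: measurable_funD.
- apply: measurable_fun_ifT => //.
  + by apply: measurable_fun_ler => //; exact: measurable_funB.
  + exact: measurable_funB.
Qed.

Lemma measurable_clamp d (X : measurableType d) h (f : X -> R) :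
  measurable_fun setT f -> measurable_fun setT (fun z => clamp h (f z)).
Proof.
by move=> mf; apply: measurable_maxr => //; exact: measurable_minr.
Qed.

End discrepancy.

Section wiener_discrepancy.
Context {R : realType} {d : measure_display} {T : measurableType d}.
Variables (P : probability T R) (W : R -> {RV P >-> R}).
Hypothesis hW : wiener_process W.

Section mesh.
Variable δ : R.
Hypothesis δ0 : 0 < δ.

Let ξ (i : nat) : {RV P >-> R} := W (i.+1%:R * δ) - W (i%:R * δ).

Let v (w : T) (i : nat) : R := W (i%:R * δ) w.

Let ξE i w : ξ i w = v w i.+1 - v w i.
Proof. by []. Qed.

Let mesh_lt i : i%:R * δ < i.+1%:R * δ.
Proof. by rewrite ltr_pM2r// ltr_nat. Qed.

Let normal k (B : set R) : measurable B ->
  distribution P (ξ k) B = normal_prob 0 (Num.sqrt δ) B.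
Proof.
move=> mB; have [_ _ H _] := hW.
have k0 : 0 <= k%:R * δ by rewrite mulr_ge0// ltW.
have := H _ _ k0 (mesh_lt k) B mB.
by have -> : k.+1%:R * δ - k%:R * δ = δ by rewrite -mulrBl -natrB// subSnn mul1r.
Qed.

Let product k (B : nat -> set R) : (forall i, measurable (B i)) ->
  (P (\bigcap_(i in `I_k) (ξ i @^-1` B i)) = \prod_(i < k) P (ξ i @^-1` B i))%E.
Proof.
move=> mB; have [_ _ _ ind] := hW.
have := ind k (fun i => i%:R * δ) (fun i => i.+1%:R * δ) _ _ (fun i => B i) _.
move=> <-//.
- congr (P _); apply/seteqP; split => w Bw.
    by move=> i _; apply: Bw => /=.
  by move=> i /= ik; exact: (Bw (Ordinal ik) I).
- by move=> i; split; [rewrite mulr_ge0// ltW|exact: mesh_lt].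
- apply/trivIsetP => i j _ _; apply: contra_neqP => /eqP/set0P[r []] /=.
  rewrite !in_itv/= => /andP[ir ri] /andP[jr rj]; apply/val_inj => /=.
  apply/eqP; rewrite eqn_leq -[(i <= j)%N]ltnS -[(j <= i)%N]ltnS; apply/andP; split.
    have := lt_le_trans ir rj; by rewrite ltr_pM2r// ltr_nat.
  have := lt_le_trans jr ri; by rewrite ltr_pM2r// ltr_nat.
Qed.

Let indep k (B : nat -> set R) : (forall i, measurable (B i)) ->
  (P (\bigcap_(i in `I_k.+1) (ξ i @^-1` B i)) =
   P (\bigcap_(i in `I_k) (ξ i @^-1` B i)) * P (ξ k @^-1` B k))%E.
Proof. by move=> mB; rewrite !product// big_ord_recr. Qed.

Let path_sum w i : v w i = \sum_(j < i) ξ j w.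
Proof.
rewrite -(big_mkord xpredT (fun j => ξ j w)).
under eq_bigr do rewrite ξE.
rewrite telescope_sumr// /v mul0r; have [-> _ _ _] := hW.
by rewrite subr0.
Qed.

Local Notation Tpast k := (g_sigma_algebraType (past ξ k)).

Let measurable_path j k : (j <= k)%N ->
  measurable_fun [set: Tpast k] ((fun w => v w j) : Tpast k -> R).
Proof.
move=> jk; rewrite (_ : (fun w => v w j) = fun w => \sum_(i < j) ξ i w); last first.
  by apply/funext => w; rewrite path_sum.
apply: measurable_sum => i; apply: measurable_past.
exact: leq_trans (ltn_ord i) jk.
Qed.

Lemma measurable_discrepancy t h e N :
  measurable_fun [set: T] (fun w => discrepancy t h e (fun i => W (i%:R * δ) w) N).
Proof.
have mv i : measurable_fun [set: T] (fun w => W (i%:R * δ) w).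
  exact: measurable_funP.
apply: measurable_funD.
  apply: measurable_funX; apply: measurable_sum => i.
  apply: measurable_funM; last exact: measurable_funB.
  apply: measurable_clamp; apply: measurable_funB => //.
  exact: (@measurable_tracker _ _ _ h e (fun i w => W (i%:R * δ) w)).
apply: measurable_funM => //; apply: measurable_funX; apply: measurable_funB => //.
by apply: measurable_sum => i; apply: measurable_funX; exact: measurable_funB.
Qed.

Lemma integral_discrepancy_le t h e N : 0 <= h -> t = N%:R * δ ->
  (\int[P]_w (discrepancy t h e (fun i => W (i%:R * δ) w) N)%:E <=
   ((t + 2 * t ^+ 2) * h ^+ 2)%:E)%E.
Proof.
move=> h0 tE.
have mv i : measurable_fun [set: T] (fun w => W (i%:R * δ) w).
  exact: measurable_funP.
have mtr i : measurable_fun [set: T]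
    (fun w => tracker h e (fun i => W (i%:R * δ) w) i).
  exact: (@measurable_tracker _ _ _ h e (fun i w => W (i%:R * δ) w)).
under eq_integral do rewrite /discrepancy EFinD.
rewrite ge0_integralD//; first last.
- apply/measurable_EFinP; apply: measurable_funM => //.
  apply: measurable_funX; apply: measurable_funB => //.
  by apply: measurable_sum => i; apply: measurable_funX; exact: measurable_funB.
- by move=> w _; rewrite lee_fin mulr_ge0 ?sqr_ge0// mulr_ge0 ?sqr_ge0.
- apply/measurable_EFinP; apply: measurable_funX; apply: measurable_sum => i.
  apply: measurable_funM; last exact: measurable_funB.
  apply: measurable_clamp; apply: measurable_funB; first exact: mv.
  exact: mtr.
- by move=> w _; rewrite lee_fin sqr_ge0.
rewrite mulrDl EFinD; apply: leeD.
  have -> : t * h ^+ 2 = N%:R * (h ^+ 2 * δ) by rewrite tE; ring.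
  (* The tracker at index [i] depends only on the samples up to [i], that is on the first [i]
     increments, so the integrand is predictable. *)
  apply: (@second_moment_transform _ _ _ P ξ δ δ0 indep normal
    (fun i w => clamp h (v w i - tracker h e (v w) i)) h).
    move=> j k jk; apply: measurable_clamp; apply: measurable_funB.
      exact: measurable_path.
    apply: (@measurable_tracker _ _ (Tpast k) h e (fun i w => v w i)) => i ij.
    by apply: measurable_path; apply: leq_trans ij jk.
  by move=> k w; exact: clamp_le.
under eq_integral do rewrite EFinM.
rewrite ge0_integralZl//; first last.
- by rewrite lee_fin mulr_ge0 ?sqr_ge0.
- by move=> w _; rewrite lee_fin sqr_ge0.
- apply/measurable_EFinP; apply: measurable_funX; apply: measurable_funB => //.
  by apply: measurable_sum => i; apply: measurable_funX; exact: measurable_funB.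
have E w : quadratic_variation (fun i => W (i%:R * δ) w) N - t =
    \sum_(i < N) (ξ i w ^+ 2 - δ).
  by rewrite sumrB sumr_const card_ord -mulr_natl -tE.
have H := @second_moment_quadratic_variation _ _ _ P ξ δ δ0 indep normal N.
under eq_integral do rewrite E.
apply: (le_trans (lee_wpmul2l _ H)).
  by rewrite lee_fin mulr_ge0 ?sqr_ge0.
by rewrite -EFinM lee_fin tE le_eqVlt; apply/orP; left; apply/eqP; ring.
Qed.

End mesh.
End wiener_discrepancy.

(** * Counting passages *)

Section passage_count.
Context {R : realType}.
Implicit Types (x : R -> R) (t η : R).

Definition samples x t n := fun i : nat => x (i%:R * (t / n.+1%:R)).

(** In [tracker_energy] the quadratic variation contributes [α], the doubled tracking sum [2 * α],
    the final square [h ^+ 2], and the jump errors at most [4 * h * u]. The condition [h < 1/8]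
    gives [3 * h ^+ 2 < h], the hysteresis condition for [e, o <= h ^+ 2]. *)
Lemma jumps_close x (m n : nat) (t e α : R) : x 0 = 0 -> 0 < t ->
  0 <= α -> 0 <= e -> e <= (2 ^- m) ^+ 2 -> (2 ^- m : R) < 8^-1 ->
  1 <= n.+1%:R * (2 ^- m) ^+ 2 :> R ->
  (forall i, (i < n.+1)%N ->
     `|samples x t n i.+1 - samples x t n i| <= (2 ^- m) ^+ 2) ->
  discrepancy t (2 ^- m) e (samples x t n) n.+1 <= α ^+ 2 ->
  let u : R := (jumps (2 ^- m) e (samples x t n) n.+1)%:R * (2 ^- m) ^+ 2 in
  `|u - t| <= 3 * α + (2 ^- m) ^+ 2 + 4 * 2 ^- m * u.
Proof.
move=> x0 t0 α0 e0; set h := 2 ^- m.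
have h0 : 0 < h by rewrite invr_gt0 exprn_gt0.
move=> eh h8 nh osc disc.
set v := samples x t n in osc disc *; set N := n.+1 in nh osc disc *.
have d0 : 0 <= h ^+ 2 by rewrite sqr_ge0.
have eoh : e + h ^+ 2 < h - e by nra.
have v0 : v 0%N = 0 by rewrite /v /samples mul0r.
have en := tracker_energy h0 e0 d0 eoh v0 osc (leqnn N).
have cl := tracker_close e0 d0 eoh v0 osc.
have V0 : 0 <= (v N - tracker h e v N) ^+ 2 by rewrite sqr_ge0.
have Vh : (v N - tracker h e v N) ^+ 2 <= h ^+ 2.
  have := cl N (leqnn N); rewrite -(real_normK (num_real (v N - _))) => c.
  by have := normr_ge0 (v N - tracker h e v N); nra.
have DE : \sum_(k < N) (v k - tracker h e v k) * (v k.+1 - v k) =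
    tracking_sum h e v N.
  apply: eq_bigr => k _; rewrite clamp_id//.
  by apply: (le_trans (ltW (cl k (ltnW (ltn_ord k))))); rewrite gerBl.
move: disc en; rewrite DE -/(quadratic_variation v N) /discrepancy.
move: (tracking_sum h e v N) (quadratic_variation v N) => D Q disc.
have QD : 0 <= (Q - t) ^+ 2 by rewrite sqr_ge0.
have D0 : 0 <= D ^+ 2 by rewrite sqr_ge0.
have Qa : (Q - t) ^+ 2 <= α ^+ 2.
  by move: disc; move: (N%:R * h ^+ 2) nh => c; nra.
have Da : D ^+ 2 <= α ^+ 2.
  by move: disc; move: (N%:R * h ^+ 2) nh => c; nra.
have sq (y : R) : y ^+ 2 <= α ^+ 2 -> - α <= y /\ y <= α.
  by move=> ya; split; nra.
have [q1 q2] := sq _ Qa; have [D1 D2] := sq _ Da.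
move: V0 Vh; move: ((v N - _) ^+ 2) => V V0 Vh.
move: (jumps h e v N)%:R (ler0n R (jumps h e v N)) => J J0.
have b1 : 2 * h * (e + h ^+ 2) * J <= 4 * h * (J * h ^+ 2).
  have : 0 <= h * J by rewrite mulr_ge0// ltW.
  by nra.
rewrite !ler_norml => /andP[n1 n2]; apply/andP; split; lra.
Qed.

Definition tracked x t (e : R -> R) := \forall m \near \oo,
  forall n0, exists2 n, (n0 <= n)%N &
    discrepancy t (2 ^- m) (e (2 ^- m)) (samples x t n) n.+1 < 2 ^- m.

Lemma tracked_passages x t η : continuous x -> x 0 = 0 -> 0 < t -> 0 < η ->
  tracked x t (fun=> 0) -> tracked x t (fun h => h ^+ 2) ->
  \forall m \near \oo,
   (forall k : nat, k%:R * (2 ^- m) ^+ 2 <= t - η ->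
      passed x m k /\ passage_time x m k <= t) /\
   (forall k : nat, passed x m k -> passage_time x m k <= t ->
      k%:R * (2 ^- m) ^+ 2 <= t + η).
Proof.
move=> cx x0 t0 η0 T0 T1.
pose α := Num.min (η / 8) 1.
have α0 : 0 < α by rewrite lt_min ltr01 divr_gt0.
have αη : α <= η / 8 by rewrite ge_min lexx.
have α1 : α <= 1 by rewrite ge_min lexx orbT.
(* From [jumps_close], [h < 1/8] and [α <= 1] one gets [u <= 2 * t + 8], whence
   [4 * h * u <= h * c / 4 < η / 4]. *)
pose c : R := 4 * (8 * t + 32).
have c0 : 0 < c by rewrite /c; lra.
near=> m.
have h0 : 0 < (2 ^- m : R) by rewrite invr_gt0 exprn_gt0.
have h8 : (2 ^- m : R) < 8^-1 by near: m; exact: near_step_size_lt.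
have hα : (2 ^- m : R) < α ^+ 2.
  by near: m; apply: near_step_size_lt; rewrite exprn_gt0.
have hη : (2 ^- m : R) < η / 8.
  by near: m; apply: near_step_size_lt; rewrite divr_gt0.
have hc : (2 ^- m : R) < η / c.
  by near: m; apply: near_step_size_lt; rewrite divr_gt0.
have H0 : forall n0, exists2 n, (n0 <= n)%N &
    discrepancy t (2 ^- m) 0 (samples x t n) n.+1 < 2 ^- m by near: m; exact: T0.
have H1 : forall n0, exists2 n, (n0 <= n)%N & discrepancy t (2 ^- m)
    ((2 ^- m) ^+ 2) (samples x t n) n.+1 < 2 ^- m by near: m; exact: T1.
set h : R := 2 ^- m in h0 h8 hα hη hc H0 H1 *.
have d0 : 0 < h ^+ 2 by rewrite exprn_gt0.
have dh : h ^+ 2 <= h by nra.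
have d3 : h ^+ 2 + h ^+ 2 < h - h ^+ 2 by nra.
have [δ δ0 osc] := uniformly_continuous_bounded t cx d0.
(* Beyond [n0] the mesh is below [δ] and [n.+1%:R * h ^+ 2 >= 1]. *)
pose n0 := Num.truncn (t / δ + (h ^+ 2)^-1).
have mesh n : (n0 <= n)%N -> [/\ 0 < t / n.+1%:R, t / n.+1%:R < δ &
    1 <= n.+1%:R * h ^+ 2].
  rewrite /n0 truncn_le_nat => Hn; have p1 : 0 < t / δ by rewrite divr_gt0.
  have p2 : 0 < (h ^+ 2)^-1 by rewrite invr_gt0.
  split; first by rewrite divr_gt0.
  - by rewrite ltr_pdivrMr// mulrC -ltr_pdivrMr//; lra.
  - by rewrite -ler_pdivrMr// mul1r; lra.
have osc' n : (n0 <= n)%N -> forall u v, 0 <= u -> u <= v ->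
    v <= u + t / n.+1%:R -> v <= t -> `|x v - x u| < h ^+ 2.
  move=> /mesh[_ nδ _] u v u0 uv vu vt; apply: osc.
    by rewrite ger0_norm// (le_trans u0).
  by rewrite ger0_norm ?subr_ge0// ltrBlDl (le_lt_trans vu)// ltrD2l.
have tE n : n.+1%:R * (t / n.+1%:R) = t by rewrite mulrC divfK// pnatr_eq0.
have oscs n : (n0 <= n)%N -> forall i, (i < n.+1)%N ->
    `|samples x t n i.+1 - samples x t n i| <= h ^+ 2.
  move=> Hn i iN; have [δ1 _ _] := mesh n Hn; apply/ltW/(osc' n Hn).
  - by rewrite mulr_ge0// ltW.
  - by rewrite ler_pM2r// ler_nat.
  - by rewrite -natr1 mulrDl mul1r.
  - by rewrite -[leRHS](tE n) ler_pM2r// ler_nat.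
have count n e : (n0 <= n)%N -> 0 <= e -> e <= h ^+ 2 ->
    discrepancy t h e (samples x t n) n.+1 < h ->
    `|(jumps h e (samples x t n) n.+1)%:R * h ^+ 2 - t| <= η.
  move=> Hn e0 eh Z; have [_ _ nd] := mesh n Hn.
  have := @jumps_close x m n t e α x0 t0 (ltW α0) e0 eh h8 nd (oscs n Hn)
    (ltW (lt_trans Z hα)).
  rewrite -/h; set u := _%:R * _ => /= H.
  have u0 : 0 <= u by rewrite mulr_ge0// ltW.
  have hct : h * c < η by rewrite -ltr_pdivlMr.
  move: H; rewrite !ler_norml => /andP[H1' H2'].
  have uB : u <= 2 * t + 8 by nra.
  have : 4 * h * u <= h * c / 4.
    have -> : h * c / 4 = 4 * h * (2 * t + 8) by rewrite /c; field.
    by rewrite ler_pM2l// mulr_gt0.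
  by move=> ?; apply/andP; split; lra.
split=> k.
- move=> kt; have [n Hn Z] := H0 n0; have [δ1 _ _] := mesh n Hn.
  have := count n 0 Hn (lexx _) (ltW d0) Z; rewrite ler_norml => /andP[J1 _].
  have dh' : h ^+ 2 < h by nra.
  have [pJ sJ] := jumps_passed cx x0 δ1 (ltW d0) dh' (oscs n Hn).
  have kJ : (k <= jumps h 0 (samples x t n) n.+1)%N.
    by rewrite -(ler_nat R) -(ler_pM2r d0); lra.
  split; first exact: passed_leq pJ.
  by apply: (le_trans (passage_time_le cx kJ pJ)); apply: (le_trans sJ); rewrite tE.
- move=> pk sk; have [n Hn Z] := H1 n0; have [δ1 _ _] := mesh n Hn.
  have := count n (h ^+ 2) Hn (ltW d0) (lexx _) Z; rewrite ler_norml => /andP[_ J2].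
  have kJ : (k <= jumps h (h ^+ 2) (samples x t n) n.+1)%N.
    apply: (passed_jumps cx x0 δ1) => //.
    + by move=> u v u0 uv vu; rewrite tE; exact: (osc' n Hn u v u0 uv vu).
    + by rewrite tE.
  have : k%:R * h ^+ 2 <= (jumps h (h ^+ 2) (samples x t n) n.+1)%:R * h ^+ 2.
    by rewrite ler_pM2r// ler_nat.
  lra.
Unshelve. all: by end_near. Qed.

End passage_count.

(** * From passage counts at rational times to uniform control of passage times *)

Section regularity.
Context {R : realType}.

Lemma near_forall_lt (Q : nat -> nat -> Prop) M :
  (forall a, \forall m \near \oo, Q a m) ->
  \forall m \near \oo, forall a, (a < M)%N -> Q a m.
Proof.
move=> HQ; elim: M => [|M IH]; first by near=> m.
have := HQ M; apply: filterS2 IH => m IH QM a.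
by rewrite ltnS leq_eqVlt => /predU1P[->//|]; exact: IH.
Unshelve. all: by end_near. Qed.

Lemma mesh_sqr m : (2 ^- m) ^+ 2 = 2 ^- (2 * m) :> R.
Proof. by rewrite mulnC exprM exprVn. Qed.

(** Sandwich on the grid of step [ρ]. If [r] lies in the cell [a], the count at time [(a + 2) * ρ]
    already exceeds [r], so [s <= r + 2 * ρ]. If [s] lies in the cell [c], the count at time
    [(c + 1) * ρ] gives [r <= s + 2 * ρ]. Finitely many grid times suffice. *)
Lemma regular_passages_of_tracked (x : R -> R) (K : R) :
  continuous x -> x 0 = 0 -> 0 < K ->
  (forall a b : nat, tracked x (a.+1%:R / b.+1%:R) (fun=> 0) /\
    tracked x (a.+1%:R / b.+1%:R) (fun h => h ^+ 2)) ->
  regular_passages x K.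
Proof.
move=> cx x0 K0 T η η0.
pose b := Num.truncn (4 / η); pose ρ : R := b.+1%:R^-1.
have ρ0 : 0 < ρ by rewrite invr_gt0.
have ρη : ρ < η / 4.
  rewrite /ρ -[ltRHS]invf_div ltf_pV2 ?posrE ?divr_gt0//.
  exact: truncnS_gt.
(* The margin [10 * ρ] leaves room for the cells of points up to [K + 2 * ρ] and their right
   neighbours. *)
pose M := (Num.truncn ((K + 10 * ρ) / ρ)).+1.
have MK : K + 10 * ρ < M%:R * ρ.
  by rewrite -ltr_pdivrMr//; exact: truncnS_gt.
have t0 (a : nat) : 0 < a.+1%:R / b.+1%:R :> R by rewrite divr_gt0.
have HQ a := tracked_passages cx x0 (t0 a) ρ0 (T a b).1 (T a b).2.
have := near_forall_lt M HQ; apply: filterS => m Hm k kK.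
have d0 : 0 < (2 ^- (2 * m) : R) by rewrite invr_gt0 exprn_gt0.
have rK : k%:R * 2 ^- (2 * m) <= K by rewrite ler_pdivrMr// exprn_gt0.
set r := k%:R * 2 ^- (2 * m) in rK *.
have r0 : 0 <= r by rewrite mulr_ge0// ltW.
have cellP (z : R) : 0 <= z -> z <= K + 2 * ρ -> let a := Num.truncn (z / ρ) in
    [/\ a%:R * ρ <= z, z < a.+1%:R * ρ & (a.+1 < M)%N].
  move=> z0 zK a.
  have az : a%:R * ρ <= z by rewrite -ler_pdivlMr// truncn_le divr_ge0// ltW.
  split=> //; first by rewrite -ltr_pdivrMr// truncnS_gt.
  rewrite -(ltr_nat R) -(ltr_pM2r ρ0); apply: le_lt_trans MK.
  by rewrite -natr1 mulrDl mul1r; lra.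
have rK2 : r <= K + 2 * ρ by lra.
have [a1 a2 aM] := cellP r r0 rK2; set a := Num.truncn _ in a1 a2 aM.
have [up _] := Hm _ aM.
have [] := up k.
  rewrite mesh_sqr -/r -/ρ -[a.+2%:R]natr1 mulrDl mul1r; lra.
rewrite -/ρ => pk sk; split => //.
have s0 := passage_time_ge0 x m k.
set s := passage_time x m k in sk s0 *.
have sr : s <= r + 2 * ρ.
  apply: (le_trans sk); rewrite -natr1 mulrDl mul1r -natr1 mulrDl mul1r; lra.
have sK : s <= K + 2 * ρ by lra.
have [c1 c2 cM] := cellP s s0 sK; set c := Num.truncn _ in c1 c2 cM.
have [_ dn] := Hm _ (ltnW cM).
have := dn k pk; rewrite -/ρ -/s mesh_sqr -/r => /(_ (ltW c2)).
rewrite -natr1 mulrDl mul1r => rs.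
rewrite ler_norml; apply/andP; split; lra.
Qed.

End regularity.

(** * Almost sure regularity of Wiener paths *)

Section wiener_paths.
Context {R : realType} {d : measure_display} {T : measurableType d}.
Variables (P : probability T R) (W : R -> {RV P >-> R}).
Hypothesis hW : wiener_process W.

Lemma ae_tracked (t : R) (e : R -> R) : 0 < t ->
  {ae P, forall w, tracked (fun u => W u w) t e}.
Proof.
move=> t0.
apply: (@ae_infinitely_often_small _ _ _ P (fun m n w => discrepancy t (2 ^- m)
  (e (2 ^- m)) (samples (fun u => W u w) t n) n.+1) (t + 2 * t ^+ 2)).
- by move=> m n; apply: (measurable_discrepancy W (t / n.+1%:R)).
- by move=> m n w; exact: discrepancy_ge0.
- move=> m n; apply: (integral_discrepancy_le hW).
  + by rewrite divr_gt0.
  + by rewrite invr_ge0 exprn_ge0.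
  + by rewrite mulrC divfK// pnatr_eq0.
Qed.

(** Gives access to the lemmas on paths continuous on the whole line; passage times and sums are
    unchanged. *)
Definition even_path (w : T) (u : R) : R := W `|u| w.

Lemma continuous_even_path w : continuous (even_path w).
Proof.
have [_ cW _ _] := hW => u.
have u0 : `[0, +oo[%classic `|u| by rewrite /= in_itv/= normr_ge0.
have /cvgrPdist_lt cu := (subspace_continuousP _ _).1 (cW w) _ u0.
apply/cvgrPdist_lt => ε e0.
have := cu ε e0; rewrite near_withinE => {}cu.
have {}cu : \forall z \near u, `[0, +oo[%classic `|z| ->
    `|W `|u| w - W `|z| w| < ε by exact: (@norm_continuous _ _ u _ cu).
by apply: filterS cu => z cz; apply: cz; rewrite /= in_itv/= normr_ge0.
Qed.

Lemma samples_even_path w t n : 0 < t ->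
  samples (even_path w) t n = samples (fun u => W u w) t n.
Proof.
move=> t0; apply/funext => i; rewrite /samples /even_path ger0_norm//.
by rewrite mulr_ge0// divr_ge0// ltW.
Qed.

Lemma ae_regular_passages (K : R) : 0 < K ->
  {ae P, forall w, regular_passages (even_path w) K}.
Proof.
move=> K0.
(* Only positive rational times enter, so countably many null sets are discarded. *)
have : {ae P, forall w, forall a b : nat,
    tracked (even_path w) (a.+1%:R / b.+1%:R) (fun=> 0) /\
    tracked (even_path w) (a.+1%:R / b.+1%:R) (fun h => h ^+ 2)}.
  apply: (@ae_foralln _ _ _ P (fun a w => forall b : nat, _ /\ _)) => a.
  apply: (@ae_foralln _ _ _ P (fun b w => _ /\ _)) => b.
  have t0 : 0 < a.+1%:R / b.+1%:R :> R by rewrite divr_gt0.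
  have := ae_tracked (fun=> 0) t0; have := ae_tracked (fun h => h ^+ 2) t0.
  apply: filterS2 => w T1 T2; split.
    by move: T2; apply: filterS => m H n0; have [n Hn Z] := H n0; exists n;
      rewrite ?samples_even_path.
  by move: T1; apply: filterS => m H n0; have [n Hn Z] := H n0; exists n;
    rewrite ?samples_even_path.
apply: filterS => w Tw.
apply: regular_passages_of_tracked => //; first exact: continuous_even_path.
by rewrite /even_path normr0; have [-> _ _ _] := hW.
Qed.

Lemma ito_sum_even_path f w K :
  ito_sum f (even_path w) K = ito_sum f (fun t => W t w) K.
Proof.
apply/funext => m; apply: eq_bigr => r _.
have E k : even_path w (passage_time (even_path w) m k) =
    W (passage_time (fun t => W t w) m k) w.
  rewrite /even_path (passage_time_normr (fun t => W t w)).
  by rewrite ger0_norm// passage_time_ge0.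
by rewrite !E.
Qed.

Lemma stratonovich_sum_even_path f w K :
  stratonovich_sum f (even_path w) K = stratonovich_sum f (fun t => W t w) K.
Proof.
apply/funext => m; apply: eq_bigr => r _.
have E k : even_path w (passage_time (even_path w) m k) =
    W (passage_time (fun t => W t w) m k) w.
  rewrite /even_path (passage_time_normr (fun t => W t w)).
  by rewrite ger0_norm// passage_time_ge0.
by rewrite !E.
Qed.

End wiener_paths.

(** * The Itô and Stratonovich formulas *)

Unset Implicit Arguments.

Theorem theorem6 (R : realType) (d : measure_display) (T : measurableType d)
    (P : probability T R) (W : R -> {RV P >-> R}) (hW : wiener_process W)
    (f : R -> R) (hf : forall x : R, derivable f x 1)
    (hf' : continuous (derive1 f)) (K : R) (hK : 0 < K) :
  [/\ {ae P, forall w, cvgn (ito_sum f (fun t => W t w) K)},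
      {ae P, forall w, cvgn (stratonovich_sum f (fun t => W t w) K)},
      {ae P, forall w,
        oriented_integral f 0 (W K w) =
        ito_integral f (fun t => W t w) K +
        2^-1 * oriented_integral (fun s => derive1 f (W s w)) 0 K}
    & {ae P, forall w,
        oriented_integral f 0 (W K w) =
        stratonovich_integral f (fun t => W t w) K}].
Proof.
have df (y : R) : is_derive y 1 f (derive1 f y).
  by rewrite derive1E; exact: derivableP.
have cf : continuous f.
  by move=> y; apply: differentiable_continuous; apply/derivable1_diffP.
(* The primitive of [f] is taken to be the oriented integral from 0 itself, so its value at [W K w]
   is the left-hand side of both formulas. *)
have dF (y : R) := is_derive_oriented_integral y cf.
have F0 := oriented_integral00 f.
have WK w : even_path W w K = W K w by rewrite /even_path gtr0_norm.
have e0 w : even_path W w 0 = 0.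
  by rewrite /even_path normr0; have [-> _ _ _] := hW.
have intE w : oriented_integral (derive1 f \o even_path W w) 0 K =
    oriented_integral (fun s => derive1 f (W s w)) 0 K.
  rewrite /oriented_integral (ltW hK); apply: eq_Rintegral => u.
  by rewrite inE/= in_itv/= => /andP[u0 _]; rewrite /even_path ger0_norm.
have ito : {ae P, forall w, ito_sum f (fun t => W t w) K @ \oo -->
    oriented_integral f 0 (W K w) -
    2^-1 * oriented_integral (fun s => derive1 f (W s w)) 0 K}.
  apply: filterS (ae_regular_passages hW hK) => w reg.
  have := cvg_ito_sum (@continuous_even_path _ _ _ P W hW w) (e0 w) hK reg
    dF F0 df hf'.
  by rewrite WK intE ito_sum_even_path.
have str : {ae P, forall w, stratonovich_sum f (fun t => W t w) K @ \oo -->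
    oriented_integral f 0 (W K w)}.
  apply: filterS (ae_regular_passages hW hK) => w reg.
  have := cvg_stratonovich_sum (@continuous_even_path _ _ _ P W hW w) (e0 w)
    hK reg dF F0 df hf'.
  by rewrite WK stratonovich_sum_even_path.
split.
- by apply: filterS ito => w cw; apply/cvg_ex; eexists; exact: cw.
- by apply: filterS str => w cw; apply/cvg_ex; eexists; exact: cw.
- apply: filterS ito => w cw; rewrite /ito_integral (cvg_lim _ cw)//.
  by rewrite subrK.
- by apply: filterS str => w cw; rewrite /stratonovich_integral (cvg_lim _ cw).
Qed.
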